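(* There is a $q$-cell structure on $\mathrm{WGr}(d,n)$ for $0<d<n$.
   Context: Fix integers $1\le d<n$, $W=(w_1,\dots,w_n)\in(\mathbb{Z}_{\ge 0})^n$ and an integer $a\ge 1$. Let $M_d(n,d)$ be the set of complex $n\times d$ matrices of rank $d$. For $A,B\in M_d(n,d)$ write $A\sim_w B$ if $B=\mathrm{diag}(t^{w_1},\dots,t^{w_n})\,A\,T$ for some $T\in \mathrm{GL}(d,\mathbb{C})$ and $t\in\mathbb{C}^*$ with $t^a=\det(T)$. The weighted Grassmann orbifold is $\mathrm{WGr}(d,n):=M_d(n,d)/\!\sim_w$ with the quotient topology. A $q$-cell of dimension $k$ is the quotient of a $k$-disk by a linear action of a finite group $G$ (its interior being $\mathbb{R}^k/G$); a $q$-cell structure on a space $X$ is a filtration of $X$, starting with a point (or discrete set), in which each stage is obtained from the preceding one by attaching a $q$-cell $D^k/G$ along a continuous map from $S^{k-1}/G$. *)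

(* Defs.v *)
From HB Require Import structures.
From Stdlib Require Import Relations.
From mathcomp Require Import all_boot all_order all_algebra all_fingroup.
From mathcomp Require Import mxrepresentation.
From mathcomp Require Import complex.
From mathcomp Require Import all_classical all_reals all_analysis.
Set Implicit Arguments.
Unset Strict Implicit.
Unset Printing Implicit Defensive.
Import Order.TTheory GRing.Theory Num.Theory.
Import numFieldTopology.Exports.
Local Open Scope classical_set_scope.
Local Open Scope quotient_scope.
Local Open Scope ring_scope.

Section Quotient.
Variables (T : topologicalType) (r : relation T).

Definition gen_equiv (x y : T) : bool := `[< clos_refl_sym_trans T r x y >].

Lemma gen_equiv_is_equiv : equiv_class_of gen_equiv.
Proof.
split=> [x|x y|y x z].
- by apply/asboolP; exact: rst_refl.
- by apply: asbool_equiv_eq; split; exact: rst_sym.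
- by move=> /asboolP xy /asboolP yz; apply/asboolP; exact: rst_trans yz.
Qed.

Canonical gen_equiv_rel : equiv_rel T := EquivRelPack gen_equiv_is_equiv.

(* T modulo the equivalence relation generated by r, with the quotient
   topology *)
Definition quotient_space : topologicalType :=
  quotient_topology {eq_quot gen_equiv_rel}.

Definition quotient_proj (x : T) : quotient_space :=
  \pi_(quotient_topology {eq_quot gen_equiv_rel}) x.

Lemma quotient_proj_eq x y :
  quotient_proj x = quotient_proj y <-> clos_refl_sym_trans T r x y.
Proof.
rewrite /quotient_proj; split=> [/eqquotP/asboolP //|xy].
by apply/eqquotP/asboolP.
Qed.

Lemma quotient_proj_eq_equiv x y : equivalence T r ->
  quotient_proj x = quotient_proj y <-> r x y.
Proof.
move=> [rr rt rs]; rewrite quotient_proj_eq; split=> [|rxy]; last exact: rst_step.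
by elim=> [//|//|u v _|u v w _ uv _ vw]; [exact: rs | exact: (rt _ _ _ uv vw)].
Qed.

End Quotient.

Section WeightedGrassmann.
Variables (R : realType) (n d : nat).

(* R[i] is registered at a numClosedFieldType so that it (hence also matrices
   over it) receives the topology of its norm. *)
Definition Cplx : numClosedFieldType := R[i].

Definition full_rank_mx : set 'M[Cplx]_(n, d) := [set A | \rank A = d].

Definition wsim (W : 'I_n -> nat) (a : nat) (A B : full_rank_mx) : Prop :=
  exists (t : Cplx) (T : 'M[Cplx]_d),
    [/\ t != 0, T \in unitmx, t ^+ a = \det T
      & \val B = diag_mx (\row_i t ^+ W i) *m \val A *m T].

Lemma wsim_equiv (W : 'I_n -> nat) (a : nat) :
  equivalence full_rank_mx (@wsim W a).
Proof.
have diag1 : diag_mx (\row_i (1 : Cplx) ^+ W i) = 1%:M.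
  by rewrite -diag_const_mx; congr diag_mx; apply/rowP=> i; rewrite !mxE expr1n.
have diagM (s t : Cplx) : diag_mx (\row_i s ^+ W i) *m diag_mx (\row_i t ^+ W i)
    = diag_mx (\row_i (s * t) ^+ W i).
  by rewrite mulmx_diag; congr diag_mx; apply/rowP=> i; rewrite !mxE exprMn.
split.
- move=> A; exists 1, 1%:M; split; rewrite ?oner_neq0 ?unitmx1//.
    by rewrite expr1n det1.
  by rewrite diag1 mul1mx mulmx1.
- move=> A B C [s [S [s0 Su sS eqB]]] [t [T [t0 Tu tT eqC]]].
  exists (t * s), (S *m T); split; first by rewrite mulf_neq0.
  + by rewrite unitmx_mul Su Tu.
  + by rewrite exprMn tT sS det_mulmx mulrC.
  + by rewrite eqC eqB !mulmxA diagM.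
- move=> A B [t [T [t0 Tu tT eqB]]].
  exists t^-1, (invmx T); split; rewrite ?invr_eq0 ?unitmx_inv//.
    by rewrite exprVn tT det_inv.
  by rewrite eqB !mulmxA diagM mulVf// diag1 mul1mx mulmxK.
Qed.

Definition WGr (W : 'I_n -> nat) (a : nat) : topologicalType :=
  quotient_space (@wsim W a).

End WeightedGrassmann.

Section QCells.
Variable R : realType.

(* Euclidean norm: the norm of the library on 'rV[R]_k is the sup norm. *)
Definition disk (k : nat) : set 'rV[R]_k := [set x | \sum_j x 0 j ^+ 2 <= 1].
Definition sphere (k : nat) : set 'rV[R]_k := [set x | \sum_j x 0 j ^+ 2 = 1].
Arguments disk : clear implicits.
Arguments sphere : clear implicits.

Section Orbits.
Variables (k : nat) (gT : finGroupType) (G : {group gT}).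
Variable rG : mx_representation R G k.

Definition acts_on_disk : Prop :=
  forall g x, g \in G -> disk k x -> disk k (x *m rG g).

Definition same_orbit (A : set 'rV[R]_k) (x y : A) : Prop :=
  exists2 g, g \in G & \val y = \val x *m rG g.

Definition orbit_space (A : set 'rV[R]_k) : topologicalType :=
  quotient_space (@same_orbit A).

End Orbits.

Section Attaching.
Variables (Y : topologicalType) (k : nat) (gT : finGroupType) (G : {group gT}).
Variable rG : mx_representation R G k.
Variable phi : orbit_space rG (sphere k) -> Y.

Definition disjoint_union : topologicalType :=
  {b : bool & if b then Y else orbit_space rG (disk k)}.

Definition in_base (y : Y) : disjoint_union := existT _ true y.
Definition in_cell (z : orbit_space rG (disk k)) : disjoint_union :=
  existT _ false z.

Variant glued : disjoint_union -> disjoint_union -> Prop :=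
| Glued (s : sphere k) (x : disk k) of \val s = \val x :
    glued (in_cell (quotient_proj _ x)) (in_base (phi (quotient_proj _ s))).

Definition adjunction_space : topologicalType := quotient_space glued.

End Attaching.

Definition homeomorphism (S T : topologicalType) (f : S -> T) : Prop :=
  exists g : T -> S, [/\ cancel f g, cancel g f, continuous f & continuous g].

(* B is obtained from A by attaching one q-cell D^k/G; k > 0 because
   0-dimensional cells belong to the initial discrete stage. *)
Definition attaches_q_cell (X : topologicalType) (A B : set X) : Prop :=
  exists (k : nat) (gT : finGroupType) (G : {group gT})
         (rG : mx_representation R G k)
         (phi : orbit_space rG (sphere k) -> A)
         (h : adjunction_space phi -> B),
    [/\ (0 < k)%N, acts_on_disk rG, continuous phi, homeomorphism h
      & forall y : A, \val (h (quotient_proj _ (in_base rG y))) = \val y].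

Definition has_q_cell_structure (X : topologicalType) : Prop :=
  exists (N : nat) (F : nat -> set X),
    [/\ forall U : set (F 0%N), open U,
        forall i, (i < N)%N ->
          F i `<=` F i.+1 /\ attaches_q_cell (F i) (F i.+1)
      & F N = setT].

End QCells.

(* Main.v *)
Require Import Defs.
From Stdlib Require Import Relations.
From mathcomp Require Import all_boot all_reals.
From mathcomp Require Import all_order all_algebra.
From mathcomp Require Import fingroup perm mxrepresentation complex.
From mathcomp Require Import separable cyclic cyclotomic.
From mathcomp Require Import all_classical all_analysis ring.

(** Through its Plücker coordinates a point of WGr(d,n) is a nonzero
    decomposable d-vector p, up to p_f |-> t^(c_f) p_f with c_f = a + sum of the
    weights of the rows in f.  As all c_f are positive, each orbit of the
    subgroup t > 0 meets the unit sphere of the Plücker space exactly once.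

    The cells are the Schubert cells, indexed by the sets S of pivot rows.  A
    closed cell is parametrized by orthonormal echelon frames: the j-th column
    is the image of a unit vector w_j, with coordinates in the free rows above
    the j-th pivot and a real pivot entry sqrt(1 - |x_j|^2) >= 0, under the
    product of the Householder reflections sending the earlier pivot vectors to
    - w_i.  These frames are continuous on the whole closed polydisk of the x_j,
    and the pivots vanish exactly on its boundary, which therefore lands in
    smaller cells.  Orthonormal frames have constant Plücker norm, so two frames
    in the interior define the same point only if |t| = 1; positivity of the
    pivots then forces t^c = 1 with c = c_S, and uniqueness of Gram-Schmidt
    identifies the fibres with the orbits of the c-th roots of unity, which act
    by linear rotations of the coordinates.  A radial homeomorphism replaces the
    polydisk by a round disk, and compactness of the disk together with the
    Hausdorff property of WGr(d,n) turns the characteristic map into a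
    homeomorphism from the adjunction space. *)

Set Implicit Arguments.
Unset Strict Implicit.
Unset Printing Implicit Defensive.
Import Order.TTheory GRing.Theory Num.Theory.
Import numFieldTopology.Exports numFieldNormedType.Exports.
Local Open Scope classical_set_scope.
Local Open Scope quotient_scope.
Local Open Scope ring_scope.

(** * Quotients, subspaces and attaching maps *)

Section QuotientSpaces.
Variables (T : topologicalType) (r : relation T).

Lemma quotient_proj_surj (q : quotient_space r) : exists x, quotient_proj r x = q.
Proof. by exists (generic_quotient.repr q); rewrite /quotient_proj reprK. Qed.

Lemma quotient_proj_continuous : continuous (quotient_proj r).
Proof. exact: pi_continuous. Qed.

Lemma quotient_space_lift (Z : topologicalType) (f : T -> Z) :
  continuous f -> (forall x y, r x y -> f x = f y) ->
  exists2 g : quotient_space r -> Z, continuous g &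
    forall x, g (quotient_proj r x) = f x.
Proof.
move=> fc fr.
have fr' x y : clos_refl_sym_trans T r x y -> f x = f y.
  by elim=> [||u v _ ->|u v w _ -> _ ->] //; exact: fr.
exists (f \o generic_quotient.repr).
  apply: repr_comp_continuous => // x y /eqP xy; apply/eqP; apply: fr'.
  exact/quotient_proj_eq.
move=> x /=; apply: fr'; apply/quotient_proj_eq.
by rewrite /quotient_proj reprK.
Qed.

Lemma quotient_space_compact : compact [set: T] -> compact [set: quotient_space r].
Proof.
move=> cT; have -> : [set: quotient_space r] = quotient_proj r @` setT.
  apply/seteqP; split=> // q _; have [x <-] := quotient_proj_surj q; by exists x.
apply: continuous_compact => //.
by apply: continuous_subspaceT; exact: quotient_proj_continuous.
Qed.

End QuotientSpaces.

Section Subtypes.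
Variables (T : topologicalType).

Lemma set_val_continuous (A : set T) : continuous (val : A -> T).
Proof. exact: initial_continuous. Qed.

Lemma set_type_continuous (S : topologicalType) (A : set T) (f : S -> A) :
  continuous (fun x => val (f x)) -> continuous f.
Proof. by move=> fc; apply: continuous_comp_initial. Qed.

(** A filter on the subspace is pushed forward along [val], and a cluster point found in [A] is
    lifted back. *)
Lemma compact_set_type (A : set T) : compact A -> compact [set: A].
Proof.
move=> cA F FF _.
have [|x [Ax clx]] := cA (val @ F)%classic _.
  by apply: (@filterS _ F _ setT) filterT => y _; exact: set_valP.
exists (exist _ x (mem_set Ax)); split=> // V U FV [_ [[W oW <-] Wx WU]].
have [||y [[z Vz zy] Wy]] := clx (val @` V) W.
- by apply: (@filterS _ F _ V) FV => z Vz; exists z.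
- by apply: open_nbhs_nbhs.
by exists z; split=> //; apply: WU; rewrite /preimage /= set_valE zy.
Qed.

Lemma set_type_hausdorff (A : set T) :
  hausdorff_space T -> hausdorff_space A.
Proof.
move=> hT x y xy; apply/val_inj/hT => U V Ux Vy.
have [||z [Uz Vz]] := xy (val @^-1` U) (val @^-1` V); last by exists (val z).
  exact: set_val_continuous.
exact: set_val_continuous.
Qed.

End Subtypes.

Lemma compact_hausdorff_homeomorphism (S T : topologicalType) (f : S -> T) :
  compact [set: S] -> hausdorff_space T -> continuous f ->
  injective f -> (forall y, exists x, f x = y) -> homeomorphism f.
Proof.
move=> cS hT fc fi fs.
have [g fg] := choice fs.
exists g; split=> //; first by move=> x; apply: fi; rewrite fg.
apply/continuous_closedP => C cC.
(* Continuity of the inverse amounts to [f] being a closed map: closed sets of the source are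
   compact, and so are their images, which are closed in a Hausdorff space. *)
have -> : g @^-1` C = f @` C.
  apply/seteqP; split=> [y Cy|y [x Cx <-]]; first by exists (g y).
  by rewrite /preimage /= (_ : g (f x) = x)//; apply: fi; rewrite fg.
apply: compact_closed => //; apply: continuous_compact.
  by apply: continuous_subspaceT.
by apply: subclosed_compact cC cS _.
Qed.

Section CompactDisk.
Variables (R : realType) (k : nat).

Lemma continuous_sum_sqr : continuous (fun x : 'rV[R]_k => \sum_j x 0 j ^+ 2).
Proof.
apply: continuous_big => [|j _]; first exact: add_continuous.
by move=> x; apply: continuousM; exact: coord_continuous.
Qed.

Lemma disk_compact : compact (@disk R k).
Proof.
have boxC : compact [set v : 'rV[R]_k | forall i, v ord0 i \in `[-1, 1]].
  apply: (@rV_compact _ _ (fun=> `[(-1 : R), 1]%classic)) => _.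
  exact: segment_compact.
apply: subclosed_compact boxC _.
- have /continuous_closedP/(_ [set x | x <= 1]) := continuous_sum_sqr.
  by move=> /(_ (@closed_le R 1)).
- move=> x; rewrite /disk /= => xD i; rewrite /= in_itv /= -ler_norml.
  rewrite -(ler_pXn2r (ltn0Sn 1)) ?nnegrE// real_normK ?num_real// expr1n.
  rewrite (le_trans _ xD)// (bigD1 i)//= lerDl.
  by apply: sumr_ge0 => j _; exact: sqr_ge0.
Qed.

End CompactDisk.

(** * A criterion for attaching a q-cell by a characteristic map *)

Section Attaching.
Variables (R : realType) (X : topologicalType) (A B : set X) (k : nat).
Variables (gT : finGroupType) (G : {group gT}) (rG : mx_representation R G k).
Variable chi : (@disk R k) -> X.

Lemma attaches_q_cell_charmap : hausdorff_space X -> compact A -> (0 < k)%N ->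
  acts_on_disk rG -> continuous chi ->
  (forall x y, same_orbit rG x y -> chi x = chi y) ->
  (forall x, A (chi x) <-> sphere (val x)) ->
  (forall x y, ~ A (chi x) -> chi x = chi y -> same_orbit rG x y) ->
  B = A `|` range chi -> attaches_q_cell R A B.
Proof.
move=> hX cA k0 aG chiC chiG chiS chiI BE.
have sd (s : (@sphere R k)) : val s \in (@disk R k).
  by apply/mem_set; have := set_valP s; rewrite /sphere /disk /= => ->.
have sA (s : @sphere R k) : chi (exist _ (val s) (sd s)) \in A.
  by apply: mem_set; apply: (iffRL (chiS _)); exact: (set_valP s).
pose phi0 (s : @sphere R k) : A := exist _ (chi (exist _ (val s) (sd s))) (sA s).
have inclC : continuous (fun s : @sphere R k => exist _ (val s) (sd s) : @disk R k).
  by apply: set_type_continuous; exact: set_val_continuous.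
have phi0C : continuous phi0.
  by apply: set_type_continuous => s; exact: (continuous_comp (inclC s) (chiC _)).
have phi0G u v : same_orbit rG u v -> phi0 u = phi0 v.
  by move=> [g Gg uv]; apply/val_inj/chiG; exists g.
have [phi phiC phiE] := quotient_space_lift phi0C phi0G.
have AB (y : A) : val y \in B by apply/mem_set; rewrite BE; left; exact: set_valP.
have cB x : chi x \in B by apply/mem_set; rewrite BE; right; exists x.
pose base (y : A) : B := exist _ (val y) (AB y).
have baseC : continuous base.
  by apply: set_type_continuous; exact: set_val_continuous.
have cellC : continuous (fun x => exist _ (chi x) (cB x) : B).
  exact: set_type_continuous.
have [|cell cell' cellE] := quotient_space_lift (r := @same_orbit _ _ _ _ rG _) cellC.
  by move=> x y xy; apply/val_inj/chiG.
pose f (b : bool) : (if b then A : topologicalType else orbit_space rG (@disk R k)) -> B :=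
  if b return (if b then A : topologicalType else orbit_space rG (@disk R k)) -> B
  then base else cell.
have fC : continuous (fun p : disjoint_union A rG => f (projT1 p) (projT2 p)).
  by apply: (@sigT_continuous _ _ _ f) => -[].
have [|h hC hE] := quotient_space_lift (r := glued phi) fC.
  move=> _ _ [s x sx]; rewrite /= cellE phiE; apply/val_inj => /=.
  by congr chi; apply/val_inj.
have cX : compact [set: adjunction_space phi].
  apply: quotient_space_compact; apply: sigT_compact => [|[]].
  - exact: finite_finset.
  - exact: compact_set_type.
  - by apply/quotient_space_compact/compact_set_type; exact: disk_compact.
exists k, gT, G, rG, phi, h; split=> //; last first.
  by move=> y; rewrite hE.
apply: compact_hausdorff_homeomorphism => //.
- exact: set_type_hausdorff.
- move=> p q; have [[b p'] <-] := quotient_proj_surj p.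
  have [[c q'] <-] := quotient_proj_surj q.
  rewrite !hE /=.
  (* A base point and a cell point with the same image are already glued, since the cell point must
     lie on the sphere. *)
  have AC (y : A) z : val y = chi z -> quotient_proj (glued phi) (in_base rG y) =
      quotient_proj (glued phi) (in_cell _ (quotient_proj _ z)).
    move=> yz; have sz : sphere (val z) by apply/chiS; rewrite -yz; exact: set_valP.
    pose s : (@sphere R k) := exist _ (val z) (mem_set sz).
    apply/quotient_proj_eq/rst_sym/rst_step.
    have -> : y = phi (quotient_proj _ s).
      by rewrite phiE; apply/val_inj; rewrite /= yz; congr chi; apply/val_inj.
    exact: Glued.
  case: b p' => p'; case: c q' => q' /=.
  + by move=> [/val_inj ->].
  + have [z <-] := quotient_proj_surj q'; rewrite cellE => -[yz].
    exact: AC.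
  + have [z <-] := quotient_proj_surj p'; rewrite cellE => -[yz].
    by apply/esym/AC.
  + have [z <-] := quotient_proj_surj p'; have [z' <-] := quotient_proj_surj q'.
    (* Two cell points with image in [A] are glued to one common base point; otherwise they lie in
       one orbit. *)
    rewrite !cellE => -[zz']; have [Az|nAz] := pselect (A (chi z)).
      pose y : A := exist _ (chi z) (mem_set Az).
      by rewrite -(AC y z)// -(AC y z').
    congr (quotient_proj _ (in_cell _ _)).
    by apply/quotient_proj_eq/rst_step/chiI.
- move=> y; have : (A `|` range chi) (val y) by rewrite -BE; exact: set_valP.
  move=> [Ay|[x _ xy]].
    pose y' : A := exist _ (val y) (mem_set Ay).
    exists (quotient_proj _ (in_base rG y')).
    by rewrite hE; apply/val_inj.
  exists (quotient_proj _ (in_cell _ (quotient_proj _ x))).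
  by rewrite hE /= cellE; apply/val_inj.
Qed.

Lemma compact_setU_charmap : compact A -> continuous chi ->
  compact (A `|` range chi).
Proof.
move=> cA chiC; apply: compactU => //; apply: continuous_compact.
  exact: continuous_subspaceT.
exact/compact_set_type/disk_compact.
Qed.

End Attaching.

(** * Frames built from Householder reflections *)

Section Reflections.
Variables (C : numClosedFieldType) (n : nat).
Implicit Types (u v w : 'cV[C]_n) (l : 'I_n).

Definition dot u v : C := \sum_i (u i 0)^* * v i 0.

Lemma dotC u v : dot v u = (dot u v)^*.
Proof.
rewrite /dot rmorph_sum /=; apply: eq_bigr => i _.
by rewrite rmorphM /= conjCK mulrC.
Qed.

Lemma dotDr u v w : dot u (v + w) = dot u v + dot u w.
Proof. by rewrite /dot -big_split; apply: eq_bigr => i _; rewrite mxE mulrDr. Qed.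

Lemma dotZr u a v : dot u (a *: v) = a * dot u v.
Proof. by rewrite /dot mulr_sumr; apply: eq_bigr => i _; rewrite mxE mulrCA. Qed.

Lemma dotNr u v : dot u (- v) = - dot u v.
Proof. by rewrite -scaleN1r dotZr mulN1r. Qed.

Lemma dotDl u v w : dot (v + w) u = dot v u + dot w u.
Proof. by rewrite dotC dotDr rmorphD /= -!dotC. Qed.

Lemma dotZl u a v : dot (a *: v) u = a^* * dot v u.
Proof. by rewrite dotC dotZr rmorphM /= -dotC. Qed.

Lemma dotNl u v : dot (- v) u = - dot v u.
Proof. by rewrite dotC dotNr rmorphN /= -dotC. Qed.

Lemma dot0r u : dot u 0 = 0.
Proof. by rewrite /dot big1 // => i _; rewrite mxE mulr0. Qed.

Lemma dot_deltal l v : dot (delta_mx l 0) v = v l 0.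
Proof.
rewrite /dot (bigD1 l) //= mxE !eqxx conjC1 mul1r big1 ?addr0 // => i il.
by rewrite mxE (negPf il) conjC0 mul0r.
Qed.

Lemma dot_deltar l v : dot v (delta_mx l 0) = (v l 0)^*.
Proof. by rewrite dotC dot_deltal. Qed.

Lemma dotE v : dot v v = \sum_i `|v i 0| ^+ 2.
Proof. by apply: eq_bigr => i _; rewrite mulrC -normCK. Qed.

Lemma dot_ge0 v : 0 <= dot v v.
Proof. by rewrite dotE; apply: sumr_ge0 => i _; rewrite exprn_ge0. Qed.

Lemma dot_eq0 v : dot v v = 0 -> v = 0.
Proof.
rewrite dotE => /eqP; rewrite psumr_eq0 => [|i _]; last by rewrite exprn_ge0.
move=> /allP v0; apply/colP => i; rewrite mxE; apply/eqP.
by have := v0 i (mem_index_enum _); rewrite /= expf_eq0 normr_eq0.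
Qed.

(* The reflection exchanging the [l]-th basis vector and [- w], for a unit vector
   [w] with [w l 0 >= 0]. *)
Definition refl w l v : 'cV[C]_n :=
  v - (dot (w + delta_mx l 0) v / (1 + w l 0)) *: (w + delta_mx l 0).

Section OneReflection.
Variables (w : 'cV[C]_n) (l : 'I_n).
Hypotheses (w1 : dot w w = 1) (wl : 0 <= w l 0).

Let u := w + delta_mx l 0.
Let c0 : 1 + w l 0 != 0.
Proof. by rewrite gt_eqF // ltr_wpDr. Qed.

Let cJ : (w l 0)^* = w l 0.
Proof. by apply/CrealP; apply: ger0_real. Qed.

Let cJ1 : (1 + w l 0)^* = 1 + w l 0.
Proof. by rewrite rmorphD /= cJ conjC1. Qed.

(** Thus the divisor in [refl] is half of [dot u u], which identifies [refl] as the Householder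
    reflection along [u]. *)
Let dot_uu : dot u u = (1 + w l 0) *+ 2.
Proof.
rewrite /u dotDr !dotDl w1 dot_deltal dot_deltar dot_deltal cJ mxE !eqxx /=.
by ring.
Qed.

Lemma refl_iso a b : dot (refl w l a) (refl w l b) = dot a b.
Proof.
rewrite /refl -/u; move: (1 + w l 0) u c0 dot_uu cJ1 => c v cn0 vv cc.
rewrite dotDr dotNr dotZr !dotDl !dotNl !dotZl vv.
rewrite (dotC v a) fmorph_div /= cc.
by field.
Qed.

Lemma refl_invol : involutive (refl w l).
Proof.
move=> a; rewrite /refl -/u; move: (1 + w l 0) u c0 dot_uu => c v cn0 vv.
rewrite [X in _ - (X / c) *: v](_ : _ = - dot v a).
  by rewrite mulNr scaleNr opprK subrK.
by rewrite dotDr dotNr dotZr vv; field.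
Qed.

Lemma refl_pivot : refl w l (delta_mx l 0) = - w.
Proof.
rewrite /refl -/u dot_deltar mxE mxE !eqxx rmorphD /= cJ conjC1.
by rewrite [w l 0 + 1]addrC divff // scale1r opprD addrCA subrr addr0.
Qed.

End OneReflection.

Lemma refl_id w l v : dot (w + delta_mx l 0) v = 0 -> refl w l v = v.
Proof. by rewrite /refl => ->; rewrite mul0r scale0r subr0. Qed.

Lemma refl_coord w l v i : w i 0 = 0 -> i != l -> refl w l v i 0 = v i 0.
Proof. by move=> wi il; rewrite !mxE wi (negPf il) addr0 mulr0 subr0. Qed.

Lemma refl_linear w l a u v :
  refl w l (a *: u + v) = a *: refl w l u + refl w l v.
Proof.
rewrite /refl dotDr dotZr scalerBr addrACA scalerA -opprD -scalerDl.
by congr (_ - _ *: _); rewrite mulrDl mulrA.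
Qed.

End Reflections.

Section Frames.
Variables (C : numClosedFieldType) (n : nat) (l : nat -> 'I_n).
Implicit Types (w : nat -> 'cV[C]_n) (v : 'cV[C]_n) (j k : nat).

(** The reflections of index [j - 1] down to 0 are applied in this order; [unrotate] applies them in
    the opposite order and is the inverse. *)
Fixpoint rotate w j v :=
  if j is j'.+1 then rotate w j' (refl (w j') (l j') v) else v.

Fixpoint unrotate w j v :=
  if j is j'.+1 then refl (w j') (l j') (unrotate w j' v) else v.

Definition frame w j := rotate w j (w j).

(** The last clause makes [w j] orthogonal to the earlier pivot vectors, which [rotate] carries to
    the negatives of the earlier frame vectors. *)
Definition admissible w j :=
  [/\ dot (w j) (w j) = 1, 0 <= w j (l j) 0,
      forall i : 'I_n, (l j < i)%N -> w j i 0 = 0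
    & forall k, (k < j)%N -> w j (l k) 0 = 0].

Lemma rotate_linear w j a u v :
  rotate w j (a *: u + v) = a *: rotate w j u + rotate w j v.
Proof. by elim: j u v => //= j IH u v; rewrite refl_linear IH. Qed.

Lemma rotateD w j u v : rotate w j (u + v) = rotate w j u + rotate w j v.
Proof. by rewrite -[u]scale1r rotate_linear !scale1r. Qed.

Lemma rotate0 w j : rotate w j 0 = 0.
Proof. by have := rotateD w j 0 0; rewrite addr0 => /eqP; rewrite -subr_eq subrr => /eqP. Qed.

Lemma rotateZ w j a v : rotate w j (a *: v) = a *: rotate w j v.
Proof. by rewrite -[a *: v]addr0 rotate_linear rotate0 addr0. Qed.

Lemma rotateN w j v : rotate w j (- v) = - rotate w j v.
Proof. by rewrite -scaleN1r rotateZ scaleN1r. Qed.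

Lemma rotate_sum w j I (r : seq I) (P : pred I) (F : I -> 'cV[C]_n) :
  rotate w j (\sum_(i <- r | P i) F i) = \sum_(i <- r | P i) rotate w j (F i).
Proof. by apply: (big_morph (rotate w j)); [exact: rotateD|exact: rotate0]. Qed.

Lemma eq_rotate w w' j v :
  (forall k, (k < j)%N -> w k = w' k) -> rotate w j v = rotate w' j v.
Proof.
elim: j v => //= j IH v ww'; rewrite ww' // IH // => k kj.
by rewrite ww' // ltnW.
Qed.

Lemma eq_frame w w' j : (forall k, (k <= j)%N -> w k = w' k) ->
  frame w j = frame w' j.
Proof.
move=> ww'; rewrite /frame ww' //; apply: eq_rotate => k kj.
by rewrite ww' // ltnW.
Qed.

Section Admissible.
Variables (w : nat -> 'cV[C]_n) (d : nat).
Hypothesis lmono : forall i j, (i < j < d)%N -> (l i < l j)%N.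
Hypothesis wadm : forall j, (j < d)%N -> admissible w j.

Lemma rotate_iso j u v : (j <= d)%N ->
  dot (rotate w j u) (rotate w j v) = dot u v.
Proof.
elim: j u v => //= j IH u v jd; rewrite IH ?(ltnW jd) //.
by have [w1 w0 _ _] := wadm jd; rewrite refl_iso.
Qed.

(** Each reflection adds a multiple of a vector supported in rows up to its own pivot. *)
Lemma rotate_coord j v (m : 'I_n) : (j <= d)%N ->
  (forall k, (k < j)%N -> (l k < m)%N) -> rotate w j v m 0 = v m 0.
Proof.
elim: j v => //= j IH v jd jm; rewrite IH ?(ltnW jd) // => [|k kj]; last first.
  by apply: jm; rewrite ltnW.
have lm := jm j (ltnSn j); have [_ _ wm _] := wadm jd.
by rewrite refl_coord ?wm // -val_eqE gtn_eqF.
Qed.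

Lemma unrotate_coord j v (m : 'I_n) : (j <= d)%N ->
  (forall k, (k < j)%N -> (l k < m)%N) -> unrotate w j v m 0 = v m 0.
Proof.
elim: j => //= j IH jd jm; have [_ _ wm _] := wadm jd.
have lm := jm j (ltnSn j).
rewrite refl_coord ?wm // -?val_eqE ?gtn_eqF //.
by rewrite IH ?(ltnW jd) // => k kj; apply: jm; rewrite ltnW.
Qed.

Lemma unrotateK j : (j <= d)%N -> cancel (unrotate w j) (rotate w j).
Proof.
elim: j => //= j IH jd v; have [w1 w0 _ _] := wadm jd.
by rewrite refl_invol ?IH // ltnW.
Qed.

(** The reflections of index above [i] act first and fix the pivot vector, because their [w]
    vanishes in row [l i]. Reflection [i] turns it into [- w i], which the remaining ones carry to
    [- frame w i]. *)
Lemma rotate_pivot i j : (i < j <= d)%N ->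
  rotate w j (delta_mx (l i) 0) = - frame w i.
Proof.
elim: j => // j IH /andP[]; rewrite ltnS leq_eqVlt => /predU1P[->|ij] jd /=.
  by have [w1 w0 _ _] := wadm jd; rewrite refl_pivot // rotateN.
rewrite refl_id ?IH ?ij ?(ltnW jd) //.
have [_ _ _ wl] := wadm jd.
rewrite dot_deltar mxE wl // mxE -val_eqE ltn_eqF ?add0r ?conjC0 //.
by rewrite lmono // ij.
Qed.

Lemma frame_coord j (m : 'I_n) : (j < d)%N -> (l j <= m)%N ->
  frame w j m 0 = w j m 0.
Proof.
move=> jd jm; rewrite /frame rotate_coord ?(ltnW jd) // => k kj.
by apply: leq_trans jm; apply: lmono; rewrite kj.
Qed.

Lemma frame_high j (m : 'I_n) : (j < d)%N -> (l j < m)%N -> frame w j m 0 = 0.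
Proof.
move=> jd jm; rewrite frame_coord ?(ltnW jm) //.
by have [_ _ + _] := wadm jd; exact.
Qed.

(** For [i < j] both vectors are images under the isometry [rotate w j], of minus a pivot vector and
    of [w j], so the product is an entry of [w j] at an earlier pivot. *)
Lemma frame_orthonormal i j : (i < d)%N -> (j < d)%N ->
  dot (frame w i) (frame w j) = (i == j)%:R.
Proof.
wlog ij : i j / (i <= j)%N.
  move=> H id jd; have [|/ltnW] := leqP i j; first by move/H; exact.
  by move=> /H ji; rewrite dotC ji // eq_sym conjC_nat.
move=> _ jd; move: ij; rewrite leq_eqVlt => /predU1P[->|ij].
  rewrite rotate_iso ?(ltnW jd) // eqxx.
  by have [-> _ _ _] := wadm jd.
rewrite -[frame w i]opprK -(rotate_pivot (j := j)) ?ij ?(ltnW jd) // ltn_eqF //.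
rewrite dotNl rotate_iso ?(ltnW jd) // dot_deltal.
by have [_ _ _ -> //] := wadm jd; rewrite oppr0.
Qed.

End Admissible.
End Frames.

(** * Plücker coordinates *)

Definition wdeg n d (W : 'I_n -> nat) a (f : {ffun 'I_d -> 'I_n}) : nat :=
  (a + \sum_i W (f i))%N.

Section Plucker.
Variables (C : numClosedFieldType) (n d : nat).
Implicit Types (A B : 'M[C]_(n, d)) (f : {ffun 'I_d -> 'I_n}).

(** All maps [f] are allowed, not only increasing ones, so that sums over [f] factor over the
    positions; each maximal minor then occurs [d!] times up to sign. *)
Definition plucker A f : C := \det (rowsub f A).

Lemma pluckerM A (T : 'M[C]_d) f : plucker (A *m T) f = plucker A f * \det T.
Proof. by rewrite /plucker -mul_rowsub_mx det_mulmx. Qed.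

Lemma plucker_diag (W : 'I_n -> nat) (t : C) A f :
  plucker (diag_mx (\row_i t ^+ W i) *m A) f =
  t ^+ (\sum_i W (f i)) * plucker A f.
Proof.
rewrite /plucker.
have -> : rowsub f (diag_mx (\row_i t ^+ W i) *m A) =
    diag_mx (\row_i t ^+ W (f i)) *m rowsub f A.
  by rewrite !mul_diag_mx; apply/matrixP => i j; rewrite !mxE.
rewrite det_mulmx det_diag expr_sum; congr (_ * _).
by apply: eq_bigr => i _; rewrite mxE.
Qed.

Lemma plucker_inj A f : plucker A f != 0 -> injective f.
Proof.
move=> pf i j fij; apply/eqP; apply: contraNT pf => ij.
apply/eqP; apply: (determinant_alternate ij) => k.
by rewrite !mxE fij.
Qed.

Lemma plucker_neq0 A : \rank A = d -> exists f, plucker A f != 0.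
Proof.
move=> rA; have fA : row_full A by rewrite /row_full rA.
exists (fullrankfun fA); rewrite -unitfE -[_ \is a _]unitmxE.
exact: fullrowsub_unit.
Qed.

Lemma plucker_rank A f : plucker A f != 0 -> \rank A = d.
Proof.
rewrite -unitfE -[_ \is a _]unitmxE -row_full_unit => /eqP rf.
apply/eqP; rewrite eqn_leq rank_leq_col -{1}rf.
by rewrite rowsubE mxrankM_maxr.
Qed.

(** The rows other than [j] of the selected submatrix are rows of the identity, so only the identity
    permutation survives in the determinant. Entries of a normalized matrix are thereby Plücker
    coordinates. *)
Lemma plucker_update (S : {ffun 'I_d -> 'I_n}) A (i : 'I_n) (j : 'I_d) :
  rowsub S A = 1%:M ->
  plucker A [ffun k => if k == j then i else S k] = A i j.
Proof.
move=> AS; rewrite /plucker /determinant (bigD1 1%g) //= odd_perm1 expr0 mul1r.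
have ASE k k' : A (S k) k' = (k == k')%:R.
  by have /matrixP/(_ k k') := AS; rewrite !mxE.
rewrite [X in X + _](_ : _ = A i j); last first.
  rewrite (bigD1 j) //= !mxE ffunE eqxx perm1 big1 ?mulr1 // => k kj.
  by rewrite mxE ffunE (negPf kj) perm1 ASE eqxx.
rewrite big1 ?addr0 // => s s1.
(* A permutation fixing every index except possibly [j] fixes [j] too. *)
have [k kj sk] : exists2 k, k != j & s k != k.
  have [/existsP[k /andP[]]|] := boolP [exists k, (k != j) && (s k != k)].
    by exists k.
  rewrite negb_exists => /forallP fs; case/eqP: s1; apply/permP => k.
  rewrite perm1; have H k' : k' != j -> s k' = k'.
    by move=> kj; have := fs k'; rewrite kj /= negbK => /eqP.
  have [->|/H//] := eqVneq k j; apply/eqP/negP => /negP sj.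
  by have := H _ sj => /perm_inj /eqP; rewrite (negPf sj).
by rewrite (bigD1 k) //= mxE ffunE (negPf kj) ASE eq_sym (negPf sk) mul0r mulr0.
Qed.

(** After normalizing the rows selected by [f] to the identity, both matrices have the same entries
    by [plucker_update]. *)
Lemma plucker_eq A B f : plucker A f != 0 ->
  (forall g, plucker A g = plucker B g) ->
  exists2 T, T \in unitmx & \det T = 1 /\ B = A *m T.
Proof.
move=> Af AB; have Bf : plucker B f != 0 by rewrite -AB.
have uA : rowsub f A \in unitmx by rewrite unitmxE unitfE.
have uB : rowsub f B \in unitmx by rewrite unitmxE unitfE.
pose T := invmx (rowsub f A) *m rowsub f B.
have dT : \det T = 1.
  rewrite det_mulmx det_inv -/(plucker A f) -/(plucker B f) AB mulVf //.
exists T; first by rewrite unitmxE dT unitr1.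
split=> //.
have E : A *m invmx (rowsub f A) = B *m invmx (rowsub f B).
  have FA : rowsub f (A *m invmx (rowsub f A)) = 1%:M.
    by rewrite -mul_rowsub_mx mulmxV.
  have FB : rowsub f (B *m invmx (rowsub f B)) = 1%:M.
    by rewrite -mul_rowsub_mx mulmxV.
  apply/matrixP => i j; rewrite -(plucker_update _ _ FA) -(plucker_update _ _ FB).
  by rewrite !pluckerM AB !det_inv -/(plucker A f) -/(plucker B f) AB.
by rewrite mulmxA E mulmxKV.
Qed.

(* Expanding both determinants and exchanging the sums turns the left-hand side
   into a sum over pairs of permutations of products of Gram matrix entries. *)
Lemma sum_plucker_orthonormal A :
  (forall i j : 'I_d, \sum_m (A m i)^* * A m j = (i == j)%:R) ->
  \sum_f `|plucker A f| ^+ 2 = d`!%:R.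
Proof.
move=> AO.
have E f : `|plucker A f| ^+ 2 = \sum_(s : 'S_d) \sum_(t : 'S_d)
    (-1) ^+ s * (-1) ^+ t * \prod_i ((A (f i) (s i))^* * A (f i) (t i)).
  rewrite normCK mulrC /plucker /determinant rmorph_sum big_distrlr /=.
  apply: eq_bigr => s _; apply: eq_bigr => t _.
  rewrite rmorphM rmorph_sign rmorph_prod mulrACA -big_split /=; congr (_ * _).
  by apply: eq_bigr => i _; rewrite !mxE.
under eq_bigr do rewrite E.
rewrite exchange_big /=.
transitivity (\sum_(s : 'S_d) (1 : C)); last first.
  by rewrite sumr_const card_Sn.
apply: eq_bigr => s _; rewrite exchange_big /= (bigD1 s) //=.
have F (t : 'S_d) : \sum_(f : {ffun 'I_d -> 'I_n}) (-1) ^+ s * (-1) ^+ t *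
    \prod_i ((A (f i) (s i))^* * A (f i) (t i)) =
    (-1) ^+ s * (-1) ^+ t * \prod_i (s i == t i)%:R.
  rewrite -mulr_sumr; congr (_ * _).
  rewrite -(bigA_distr_bigA (fun i m => (A m (s i))^* * A m (t i))).
  by apply: eq_bigr => i _; rewrite AO.
rewrite F -expr2 sqrr_sign mul1r big1 => [|i _]; last by rewrite eqxx.
rewrite big1 ?addr0 // => t ts; rewrite F.
have [i si] : exists i, s i != t i.
  apply/existsP; apply: contraR ts; rewrite negb_exists => /forallP st.
  by apply/eqP/permP => i; have := st i; rewrite negbK => /eqP.
by rewrite (bigD1 i) //= (negPf si) mul0r mulr0.
Qed.

End Plucker.

(** * Schubert cells *)

Section SchubertCells.
Variables (C : numClosedFieldType) (n d : nat) (i0 : 'I_n).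
Implicit Types (A B : 'M[C]_(n, d)) (f g : {ffun 'I_d -> 'I_n}) (S : {set 'I_n}).

Definition pivot S (j : nat) : 'I_n := nth i0 (enum S) j.

Definition pivots S : {ffun 'I_d -> 'I_n} := [ffun j : 'I_d => pivot S j].

(** A sum of row indices, unrelated to [W]. It serves as a numerical substitute for the Bruhat
    order: the boundary of a cell lies in cells of strictly smaller weight. *)
Definition weight f : nat := \sum_j f j.

(** The Schubert cell is read off from which Plücker coordinates vanish, a property that the
    weighted action visibly preserves. *)
Definition in_cell A S : Prop :=
  [/\ #|S| = d, plucker A (pivots S) != 0
    & forall f, plucker A f != 0 -> (weight f <= weight (pivots S))%N].

Lemma pivot_mono S i j : (i < j < #|S|)%N -> (pivot S i < pivot S j)%N.
Proof.
move=> /andP[ij jS]; rewrite cardE in jS.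
have sS : sorted (fun x y : 'I_n => (x < y)%N) (enum S).
  rewrite {1}/enum_mem; apply: sorted_filter; first exact: (@ltn_trans).
  rewrite -enumT; have := iota_ltn_sorted 0 n.
  by rewrite -val_enum_ord sorted_map.
apply: (sorted_ltn_nth _ _ sS) => //; first by move=> ? ? ?; exact: ltn_trans.
by rewrite inE (ltn_trans ij).
Qed.

Lemma pivot_in S j : (j < #|S|)%N -> pivot S j \in S.
Proof. by move=> jS; rewrite -mem_enum mem_nth // -cardE. Qed.

Lemma pivotP S i : i \in S -> exists2 j, (j < #|S|)%N & pivot S j = i.
Proof.
rewrite -mem_enum => iS; exists (index i (enum S)); last exact: nth_index.
by rewrite cardE index_mem.
Qed.

Lemma pivot_inj S i j : (i < #|S|)%N -> (j < #|S|)%N ->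
  pivot S i = pivot S j -> i = j.
Proof.
by rewrite cardE => iS jS /eqP; rewrite nth_uniq ?enum_uniq // => /eqP.
Qed.

Lemma pivots_inj S : #|S| = d -> injective (pivots S).
Proof.
move=> Sd i j; rewrite !ffunE => /pivot_inj ij; apply/val_inj.
by apply: ij; rewrite Sd.
Qed.

Lemma weight_pivots S : #|S| = d -> weight (pivots S) = (\sum_(i in S) i)%N.
Proof.
move=> Sd; rewrite -big_enum (big_nth i0) -cardE Sd big_mkord.
by apply: eq_bigr => j _; rewrite ffunE.
Qed.

Lemma plucker_perm A f g (s : 'S_d) : (forall j, f j = g (s j)) ->
  plucker A f != 0 -> plucker A g != 0.
Proof.
move=> fg; have -> : plucker A f = (-1) ^+ s * plucker A g.
  rewrite /plucker (_ : rowsub f A = row_perm s (rowsub g A)).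
    by rewrite row_permE det_mulmx det_perm.
  by apply/matrixP => i j; rewrite !mxE fg.
by apply: contraNneq => ->; rewrite mulr0.
Qed.

Lemma pivots_perm S f : #|S| = d -> injective f -> (forall j, f j \in S) ->
  exists s : 'S_d, forall j, f j = pivots S (s j).
Proof.
move=> Sd fi fS.
have H j : exists k, f j == pivots S k.
  have [k kS fk] := pivotP (fS j); rewrite Sd in kS.
  by exists (Ordinal kS); rewrite ffunE fk.
have [s0 s0P] := choice H.
have s0i : injective s0.
  by move=> i j ij; apply: fi; rewrite (eqP (s0P i)) (eqP (s0P j)) ij.
by exists (perm s0i) => j; rewrite permE; apply/eqP.
Qed.

Lemma weight_perm f g (s : 'S_d) : (forall j, f j = g (s j)) -> weight f = weight g.
Proof.
move=> fg; rewrite /weight [RHS](reindex_inj (@perm_inj _ s)).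
by apply: eq_bigr => j _; rewrite fg.
Qed.

Lemma in_cell_exists A : \rank A = d -> exists S, in_cell A S.
Proof.
move=> /plucker_neq0[f0 Af0].
have [f Af fmax] := @arg_maxnP _ f0 (fun f => plucker A f != 0) weight Af0.
have fi := plucker_inj Af.
have Sd : #|[set f j | j : 'I_d]| = d by rewrite card_imset // card_ord.
have [|s sP] := pivots_perm Sd fi; first by move=> j; apply: imset_f.
exists [set f j | j : 'I_d]; split=> //; first exact: plucker_perm sP Af.
by rewrite -(weight_perm sP).
Qed.

Definition echelon B S := forall (i : 'I_n) (j : 'I_d), (pivot S j < i)%N -> B i j = 0.

(** Once the pivot rows are normalized, an entry below the pivot of its column is the Plücker
    coordinate with that pivot exchanged for the lower row. Its weight exceeds the maximum, so it
    vanishes. *)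
Lemma in_cell_echelon A S : in_cell A S ->
  exists2 T, T \in unitmx & rowsub (pivots S) (A *m T) = 1%:M /\ echelon (A *m T) S.
Proof.
move=> [Sd AS Amax].
have uA : rowsub (pivots S) A \in unitmx by rewrite unitmxE unitfE.
exists (invmx (rowsub (pivots S) A)); first by rewrite unitmx_inv.
have A1 : rowsub (pivots S) (A *m invmx (rowsub (pivots S) A)) = 1%:M.
  by rewrite -mul_rowsub_mx mulmxV.
split=> // i j ij; rewrite -(plucker_update _ _ A1) pluckerM.
set f := (X in plucker A X); apply/eqP; rewrite mulf_eq0; apply/orP; left.
apply: contraTT (ij) => /Amax; rewrite -leqNgt /weight.
rewrite (bigD1 j) //= ffunE eqxx [leqRHS](bigD1 j) //= !ffunE.
rewrite [X in (_ + X <= _)%N](eq_bigr (fun k => pivots S k : nat)).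
  by rewrite leq_add2r.
by move=> k kj; rewrite ffunE (negPf kj).
Qed.

(** A nonzero term of the determinant yields a permutation [s] with [f j <= pivot S (s j)] for all
    [j]. Summation bounds the weight, and equality of the sums forces equality in every term. *)
Lemma echelon_weight B S f : #|S| = d -> echelon B S -> plucker B f != 0 ->
  (weight f <= weight (pivots S))%N /\
  (weight f = weight (pivots S) -> forall j, f j \in S).
Proof.
move=> Sd BS Bf.
have [s fs] : exists s : 'S_d, forall j, (f j <= pivot S (s j))%N.
  apply/not_existsP => H; case/eqP: Bf; rewrite /plucker /determinant big1 // => s _.
  have [j] : exists j, ~ (f j <= pivot S (s j))%N by apply/existsNP/H.
  move=> /negP; rewrite -ltnNge => fj.
  by rewrite (bigD1 j) //= mxE BS // mul0r mulr0.
have wE : weight (pivots S) = (\sum_j pivot S (s j))%N.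
  rewrite /weight (reindex_inj (@perm_inj _ s)).
  by apply: eq_bigr => j _; rewrite ffunE.
split; first by rewrite wE leq_sum.
rewrite wE => fE j.
have fl : forall j, true -> (f j <= pivot S (s j) ?= iff (f j == pivot S (s j) :> nat))%N.
  by move=> k _; split=> //; exact: fs.
have [_] := leqif_sum fl; rewrite -/(weight f) fE eqxx => /esym/forallP/(_ j) /=.
by move=> /eqP/val_inj ->; rewrite pivot_in // Sd.
Qed.

Lemma plucker_unit A T f : T \in unitmx ->
  (plucker (A *m T) f != 0) = (plucker A f != 0).
Proof.
by rewrite pluckerM mulf_eq0 negb_or unitmxE unitfE => ->; rewrite andbT.
Qed.

(** Both pivot sets have maximal weight, so the equality case of [echelon_weight] puts one inside
    the other. *)
Lemma in_cell_unique A S S' : in_cell A S -> in_cell A S' -> S = S'.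
Proof.
move=> AS AS'; have [Sd pS mS] := AS; have [Sd' pS' mS'] := AS'.
have [T uT [_ eT]] := in_cell_echelon AS.
have [|_ H] := echelon_weight (f := pivots S') Sd eT; first by rewrite plucker_unit.
have /H {}H : weight (pivots S') = weight (pivots S).
  by apply/eqP; rewrite eqn_leq mS // mS'.
apply/esym/eqP; rewrite eqEcard Sd Sd' leqnn andbT; apply/fintype.subsetP => i.
by move=> /pivotP[j]; rewrite Sd' => jd <-; have := H (Ordinal jd); rewrite ffunE.
Qed.

Lemma echelon_in_cell B S : #|S| = d -> echelon B S ->
  plucker B (pivots S) != 0 -> in_cell B S.
Proof. by move=> Sd eB pB; split=> // f /(echelon_weight Sd eB)[]. Qed.

(** With equal weights [S'] would consist of the rows of [S], making its nonzero coordinate equal up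
    to sign to the vanishing one. This is what sends the boundary of a cell to earlier cells. *)
Lemma echelon_lower B S S' : #|S| = d -> echelon B S ->
  plucker B (pivots S) = 0 -> in_cell B S' ->
  (weight (pivots S') < weight (pivots S))%N.
Proof.
move=> Sd eB pB [Sd' pS' _]; have [le eqw] := echelon_weight Sd eB pS'.
rewrite ltn_neqAle le andbT; apply/negP => /eqP/eqw S'S.
have [s sP] := pivots_perm Sd (pivots_inj Sd') S'S.
by have := plucker_perm sP pS'; rewrite pB eqxx.
Qed.

Definition free_entries S : {set 'I_d * 'I_n} :=
  [set p : 'I_d * 'I_n | (p.2 < pivot S p.1)%N && (p.2 \notin S)].

Lemma free0_lower S : #|S| = d -> free_entries S = finset.set0 ->
  forall i j : 'I_n, j \in S -> (i < j)%N -> i \in S.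
Proof.
move=> Sd S0 i j jS ij; apply/negP => /negP iS.
have [k] := pivotP jS; rewrite Sd => kd kj.
by have := finset.in_set0 (Ordinal kd, i); rewrite -S0 inE /= kj ij iS.
Qed.

(** Such sets are closed downwards, and downward closed sets of the same size coincide. Hence only
    one cell is a point. *)
Lemma free0_unique S S' : #|S| = d -> #|S'| = d ->
  free_entries S = finset.set0 -> free_entries S' = finset.set0 -> S = S'.
Proof.
move=> Sd Sd' /(free0_lower Sd) H /(free0_lower Sd') H'.
have [SS|/subsetPn[i iS iS']] := boolP (S \subset S').
  by apply/eqP; rewrite eqEcard SS Sd Sd' leqnn.
apply/esym/eqP; rewrite eqEcard Sd Sd' leqnn andbT; apply/fintype.subsetP => j jS'.
have [ji|ij|/val_inj ->//] := ltngtP j i; first exact: H iS ji.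
by rewrite (H' _ _ jS' ij) in iS'.
Qed.

(** Exchanging a pivot for a free row above it would lower the weight. *)
Lemma weight_min_free0 S : #|S| = d ->
  (forall S', #|S'| = d -> (weight (pivots S) <= weight (pivots S'))%N) ->
  free_entries S = finset.set0.
Proof.
move=> Sd Smin; apply/eqP/set0Pn => -[[j i]]; rewrite inE /= => /andP[ij iS].
have jS : pivot S j \in S by rewrite pivot_in // Sd.
pose S' := i |: S :\ pivot S j.
have iS' : i \notin S :\ pivot S j by rewrite inE negb_and iS orbT.
have Sd' : #|S'| = d.
  by rewrite cardsU1 iS'; apply: etrans Sd; rewrite [RHS](cardsD1 (pivot S j)) jS.
have := Smin _ Sd'; rewrite !weight_pivots // (big_setD1 _ jS) /= big_setU1 //=.
by rewrite leq_add2r leqNgt ij.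
Qed.

End SchubertCells.

(** * Gram-Schmidt: existence, uniqueness and torus equivariance of frames *)

Section FrameMatrices.
Variables (C : numClosedFieldType) (n d : nat) (l : nat -> 'I_n).
Implicit Types (w : nat -> 'cV[C]_n).
Hypothesis lmono : forall i j, (i < j < d)%N -> (l i < l j)%N.

Definition frame_mx w : 'M[C]_(n, d) := \matrix_(i, j) frame l w j i 0.

Definition generic w :=
  forall j, (j < d)%N -> admissible l w j /\ 0 < w j (l j) 0.

Lemma frame_mx_orthonormal w : (forall j, (j < d)%N -> admissible l w j) ->
  forall i j : 'I_d, \sum_m (frame_mx w m i)^* * frame_mx w m j = (i == j)%:R.
Proof.
move=> wa i j; rewrite -val_eqE -(frame_orthonormal lmono wa (ltn_ord i) (ltn_ord j)).
by apply: eq_bigr => m _; rewrite !mxE.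
Qed.

(* Gram-Schmidt, performed in the coordinates rotated by the previous columns. *)
Lemma echelon_frame (B : 'M[C]_(n, d)) :
  (forall (i : 'I_n) (j : 'I_d), (l j < i)%N -> B i j = 0) ->
  (forall j : 'I_d, B (l j) j != 0) ->
  exists2 w, generic w & exists T, frame_mx w = B *m T.
Proof.
move=> Bhigh Bpiv.
suff [w wP] : exists w, forall j, (j < d)%N ->
    [/\ admissible l w j, 0 < w j (l j) 0 & exists t, frame l w j = B *m t].
  exists w; first by move=> j /wP[].
  have /choice[t tP] (j : 'I_d) : exists t, frame l w j = B *m t.
    by have [_ _] := wP j (ltn_ord j).
  exists (\matrix_(i, j) t j i 0); apply/matrixP => i j.
  by rewrite mxE tP !mxE; apply: eq_bigr => k _; rewrite mxE.
suff H m : (m <= d)%N -> exists w, forall j, (j < m)%N ->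
    [/\ admissible l w j, 0 < w j (l j) 0 & exists t, frame l w j = B *m t].
  exact: H.
elim: m => [|m IH] md; first by exists (fun=> 0).
have [w wP] := IH (ltnW md).
have wa j : (j < m)%N -> admissible l w j by move=> /wP[].
have lm i j : (i < j < m)%N -> (l i < l j)%N.
  by move=> /andP[ij jm]; apply: lmono; rewrite ij (ltn_trans jm).
have lkm k : (k < m)%N -> (l k < l m)%N by move=> km; apply: lmono; rewrite km.
pose jm := Ordinal md.
(* Column [m] is written in the rotated coordinates. Deleting its entries at the earlier pivots
   removes its components along the earlier frame vectors and leaves the rows from [l m] on
   unchanged. *)
pose y := unrotate l w m (col jm B).
pose y' := y - \sum_(k < m) y (l k) 0 *: delta_mx (l k) 0.
have y'E (i : 'I_n) : (forall k, (k < m)%N -> l k != i) -> y' i 0 = y i 0.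
  move=> H; rewrite !mxE summxE big1 ?subr0 // => k _.
  by rewrite !mxE eq_sym (negPf (H _ _)) // mulr0.
have y'high (i : 'I_n) : (l m <= i)%N -> y' i 0 = B i jm.
  move=> mi; rewrite y'E => [|k km]; last first.
    by rewrite -val_eqE ltn_eqF // (leq_trans (lkm k km)).
  rewrite (unrotate_coord wa) ?mxE // => k km.
  exact: leq_trans (lkm k km) mi.
have y'low k : (k < m)%N -> y' (l k) 0 = 0.
  move=> km; rewrite !mxE summxE (bigD1 (Ordinal km)) //= !mxE !eqxx mulr1.
  rewrite big1 ?addr0 ?subrr // => k' k'k; rewrite !mxE.
  rewrite (_ : (l k == l k') = false) ?mulr0 //; apply/negbTE.
  have := k'k; rewrite -!val_eqE /= neq_ltn => /orP[kk|kk].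
    by rewrite gtn_eqF // lm // kk.
  by rewrite ltn_eqF // lm // kk ltn_ord.
have [t' y't] : exists t, rotate l w m y' = B *m t.
  have /choice[t tP] (j : 'I_m) : exists t, frame l w j = B *m t.
    by have [_ _] := wP j (ltn_ord j).
  exists (delta_mx jm 0 + \sum_(k < m) y (l k) 0 *: t k).
  rewrite rotateD rotateN rotate_sum (unrotateK wa) // mulmxDr -colE.
  rewrite mulmx_sumr -sumrN; congr (_ + _); apply: eq_bigr => k _.
  rewrite rotateZ (rotate_pivot lm wa) ?ltn_ord ?leqnn //.
  by rewrite scalerN opprK -scalemxAr tP.
have p0 : y' (l m) 0 != 0 by rewrite y'high //; exact: (Bpiv jm).
have D0 : 0 < dot y' y'.
  rewrite lt_neqAle dot_ge0 andbT eq_sym; apply: contraNneq p0 => /dot_eq0 ->.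
  by rewrite mxE.
pose r := sqrtC (dot y' y').
have r0 : 0 < r by rewrite sqrtC_gt0.
(* This scalar normalizes the length and cancels the phase of the pivot entry. *)
pose al := (y' (l m) 0)^* / (`|y' (l m) 0| * r).
have np0 : `|y' (l m) 0| != 0 by rewrite normr_eq0.
have alE : al * y' (l m) 0 = `|y' (l m) 0| / r.
  have nn := normCK (y' (l m) 0).
  rewrite /al mulrAC [_^* * _]mulrC -nn expr2; field.
  by rewrite np0 gt_eqF.
have al1 : al^* * al = r ^- 2.
  rewrite /al fmorph_div rmorphM /= conjCK (CrealP (normr_real _)).
  have /CrealP -> : r \is Num.real by rewrite ger0_real // ltW.
  rewrite mulrACA -normCK -invfM mulrACA -!expr2 invfM mulVKf //.
  by rewrite expf_neq0.
pose w' k := if k == m then al *: y' else w k.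
have w'E k' : (k' < m)%N -> w k' = w' k' by move=> km; rewrite /w' ltn_eqF.
have w'm : w' m = al *: y' by rewrite /w' eqxx.
exists w' => j; rewrite ltnS leq_eqVlt => /predU1P[->|jm']; last first.
  rewrite -(@eq_frame _ _ l w); last by move=> k kj; apply/w'E/leq_ltn_trans/jm'.
  by rewrite /admissible -w'E //; exact: wP.
split.
- split; rewrite w'm.
  + by rewrite dotZr dotZl mulrCA mulrA al1 -(sqrtCK (dot y' y')) mulVf // expf_neq0 // gt_eqF.
  + by rewrite mxE alE divr_ge0 // ltW.
  + by move=> i mi; rewrite mxE y'high ?(ltnW mi) // Bhigh // mulr0.
  + by move=> k km; rewrite mxE y'low // mulr0.
- by rewrite w'm mxE alE divr_gt0 // normr_gt0.
- exists (al *: t'); rewrite /frame w'm -(eq_rotate _ _ w'E) rotateZ y't.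
  by rewrite scalemxAr.
Qed.

(** By induction on the column: echelon form kills the entries of [T] below the diagonal,
    orthonormality those above it, and the positive pivots make the diagonal entry 1. Equal frame
    vectors then give equal [w], since the common [rotate] is an isometry. *)
Lemma generic_frame_unique w w' (T : 'M[C]_d) : generic w -> generic w' ->
  frame_mx w' = frame_mx w *m T -> forall j, (j < d)%N -> w j = w' j.
Proof.
move=> wg wg' wT.
have wa j : (j < d)%N -> admissible l w j by move=> /wg[].
have wa' j : (j < d)%N -> admissible l w' j by move=> /wg'[].
have fE (j : 'I_d) : frame l w' j = \sum_k T k j *: frame l w k.
  apply/colP => i; have /matrixP/(_ i j) := wT; rewrite !mxE summxE => ->.
  by apply: eq_bigr => k _; rewrite !mxE mulrC.
move=> j; elim/ltn_ind: j => j IH jd; pose jo := Ordinal jd.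
have IHw k : (k < j)%N -> w k = w' k.
  by move=> kj; apply: IH => //; exact: ltn_trans kj jd.
have IHf k : (k < j)%N -> frame l w k = frame l w' k.
  move=> kj; apply: eq_frame => k' k'k.
  by apply: IH; [apply: leq_ltn_trans kj|apply: leq_ltn_trans (ltn_trans kj jd)].
have Thigh (k : 'I_d) : (j < k)%N -> T k jo = 0.
  move=> jk; apply/eqP/negP => /negP Tk.
  (* In row [l k0], for the largest offending index [k0], a single term of the combination survives,
     while the left-hand frame vector vanishes there. *)
  have [k0 /andP[jk0 Tk0] kmax] := @arg_maxnP _ k
    (fun k : 'I_d => (j < k)%N && (T k jo != 0)) (fun k => k : nat) (introT andP (conj jk Tk)).
  have := fE jo; move=> /colP/(_ (l k0)); rewrite (frame_high lmono wa') //; last first.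
    by apply: lmono; rewrite jk0 /=.
  rewrite summxE (bigD1 k0) //= big1 ?addr0 => [|k' k'k0].
    rewrite mxE (frame_coord lmono wa) // => /esym/eqP.
    by rewrite mulf_eq0 (negPf Tk0) /= gt_eqF //; have [] := wg k0 (ltn_ord k0).
  have [k'l|lk'|/val_inj kk] := ltngtP k' k0.
  - by rewrite mxE (frame_high lmono wa) ?mulr0 // lmono // k'l /=.
  - have [->|Tk'] := eqVneq (T k' jo) 0; first by rewrite mxE mul0r.
    have : (k' <= k0)%N by apply: kmax; rewrite Tk' (ltn_trans jk0).
    by rewrite leqNgt lk'.
  - by rewrite kk eqxx in k'k0.
have TE (k : 'I_d) : T k jo = dot (frame l w k) (frame l w' j).
  rewrite (fE jo).
  have dsum u (F : 'I_d -> 'cV[C]_n) : dot u (\sum_k F k) = \sum_k dot u (F k).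
    by apply: (big_morph (dot u)); [exact: dotDr|exact: dot0r].
  rewrite dsum (bigD1 k) //= dotZr (frame_orthonormal lmono wa) // eqxx mulr1.
  rewrite big1 ?addr0 // => k' k'k.
  by rewrite dotZr (frame_orthonormal lmono wa) // val_eqE eq_sym (negPf k'k) mulr0.
have fj : frame l w' j = T jo jo *: frame l w j.
  rewrite (fE jo) (bigD1 jo) //= big1 ?addr0 // => k kj.
  have [kl|lk|/val_inj kk] := ltngtP k jo.
  - by rewrite TE IHf // (frame_orthonormal lmono wa') ?ltn_eqF ?scale0r.
  - by rewrite Thigh ?scale0r.
  - by rewrite kk eqxx in kj.
have [_ wp] := wg j jd; have [_ wp'] := wg' j jd.
have T0 : 0 < T jo jo.
  have := fj; move=> /colP/(_ (l j)); rewrite mxE !(frame_coord lmono) // => E.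
  by rewrite -(pmulr_lgt0 _ wp) -E.
have T1 : T jo jo = 1.
  have := frame_orthonormal lmono wa' jd jd.
  rewrite fj dotZr dotZl (frame_orthonormal lmono wa) // eqxx mulr1.
  rewrite (CrealP (gtr0_real T0)) -expr2 => /eqP.
  by rewrite sqrf_eq1 => /orP[/eqP //|/eqP TN]; rewrite TN ltr0N1 in T0.
move: fj; rewrite T1 scale1r /frame -(eq_rotate _ _ IHw) => E.
apply/eqP; rewrite -subr_eq0; apply/eqP/dot_eq0.
rewrite -(rotate_iso wa _ _ (ltnW jd)) rotateD rotateN E subrr dot0r //.
Qed.

Definition torus_act (z : 'I_n -> C) (v : 'cV[C]_n) : 'cV[C]_n := \col_i (z i * v i 0).

(** The phase [(z (l j))^*] keeps the pivot entry of [w j] unchanged, so the vector defining the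
    reflection is also transformed by the torus up to that phase. A reflection ignores phases, hence
    the new reflections are the torus conjugates of the old ones. *)
Lemma frame_torus (z : 'I_n -> C) w w' : (forall i, `|z i| = 1) ->
  (forall j, (j < d)%N -> w' j = (z (l j))^* *: torus_act z (w j)) ->
  forall j, (j < d)%N -> frame l w' j = (z (l j))^* *: torus_act z (frame l w j).
Proof.
move=> z1 w'E.
have zz i : (z i)^* * z i = 1 by rewrite mulrC -normCK z1 expr1n.
have tZ a v : torus_act z (a *: v) = a *: torus_act z v.
  by apply/colP => i; rewrite !mxE mulrCA.
have tD u v : torus_act z (u + v) = torus_act z u + torus_act z v.
  by apply/colP => i; rewrite !mxE mulrDr.
have tN u : torus_act z (- u) = - torus_act z u.
  by apply/colP => i; rewrite !mxE mulrN.
have tdot u v : dot (torus_act z u) (torus_act z v) = dot u v.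
  by apply: eq_bigr => i _; rewrite !mxE rmorphM mulrACA zz mul1r.
have tdelta i : delta_mx i 0 = (z i)^* *: torus_act z (delta_mx i 0).
  apply/colP => k; rewrite !mxE; have [->|_] := eqVneq k i; last by rewrite !mulr0.
  by rewrite mulr1 zz.
have rE j v : (j < d)%N ->
    refl (w' j) (l j) (torus_act z v) = torus_act z (refl (w j) (l j) v).
  move=> jd.
  have uE : w' j + delta_mx (l j) 0 = (z (l j))^* *: torus_act z (w j + delta_mx (l j) 0).
    by rewrite w'E // {1}(tdelta (l j)) -scalerDr -tD.
  have wE : w' j (l j) 0 = w j (l j) 0 by rewrite w'E // !mxE mulrA zz mul1r.
  rewrite /refl uE wE; move: (w j + _) => u.
  rewrite dotZl conjCK tdot tD tN tZ scalerA.
  congr (_ - _ *: _); rewrite mulrC !mulrA zz mul1r //.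
have roE j v : (j <= d)%N ->
    rotate l w' j (torus_act z v) = torus_act z (rotate l w j v).
  by elim: j v => //= j IH v jd; rewrite rE // IH // ltnW.
by move=> j jd; rewrite /frame w'E // rotateZ roE // ltnW.
Qed.

End FrameMatrices.

(** * The topology of the weighted Grassmannian *)

Section ComplexTopology.
Variable R : realType.

Definition RtoC (x : R) : Cplx R := (x%:C)%C.

Lemma RtoC_continuous : continuous RtoC.
Proof.
move=> x; apply/cvgrPdist_lt => e e0.
have eE : e = RtoC (complex.Re e) by rewrite /RtoC RRe_real // gtr0_real.
rewrite eE in e0 *; rewrite /RtoC ltcR in e0.
near=> y; rewrite /RtoC -rmorphB /= normc_def /= expr0n /= addr0 sqrtr_sqr ltcR.
by near: y; apply: cvgr_dist_lt.
Unshelve. all: by end_near. Qed.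

Lemma cplxE (z : Cplx R) : z = RtoC (complex.Re z) + 'i%C * RtoC (complex.Im z).
Proof. exact: complexE. Qed.

Lemma norm_le_Re_Im (z : Cplx R) (M : R) : `|z| <= RtoC M ->
  complex.Re z \in `[- M, M] /\ complex.Im z \in `[- M, M].
Proof.
rewrite normc_def /RtoC lecR => zM.
rewrite !in_itv /= -!ler_norml -!sqrtr_sqr; split; apply: le_trans zM.
  by rewrite ler_wsqrtr // lerDl sqr_ge0.
by rewrite ler_wsqrtr // lerDr sqr_ge0.
Qed.

Lemma closed_disc_compact (M : R) :
  exists2 K : set (Cplx R), compact K & forall z : Cplx R, `|z| <= RtoC M -> K z.
Proof.
pose g (p : R * R) : Cplx R := RtoC p.1 + ('i%C : Cplx R) * RtoC p.2.
exists (g @` (`[- M, M]%classic `*` `[- M, M]%classic)).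
  apply: continuous_compact; last by apply: compact_setX; exact: segment_compact.
  apply: continuous_subspaceT => p; apply: cvgD.
    by apply: continuous_comp; [exact: cvg_fst|exact: RtoC_continuous].
  apply: cvgM; first exact: cvg_cst.
  by apply: continuous_comp; [exact: cvg_snd|exact: RtoC_continuous].
move=> z /norm_le_Re_Im[zr zi].
exists (complex.Re z, complex.Im z) => //.
by rewrite /g /= -cplxE.
Qed.

End ComplexTopology.

Section MatrixContinuity.
Variables (K : numFieldType).

Lemma mx_continuous (T : topologicalType) m n (f : T -> 'M[K]_(m, n)) (x : T) :
  (forall i j, {for x, continuous (fun y => f y i j)}) -> {for x, continuous f}.
Proof.
move=> fc A [P nP PA]; apply: (@filterS _ _ _ [set y | forall i j, P i j (f y i j)]).
  by move=> y; exact: PA.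
do 2 (apply: filter_forall => ?); exact: fc.
Qed.

Lemma coord_continuous_comp (T : topologicalType) m n (f : T -> 'M[K]_(m, n))
    (x : T) i j :
  {for x, continuous f} -> {for x, continuous (fun y => f y i j)}.
Proof.
move=> fc; apply: (@continuous_comp _ _ _ f (fun y : 'M[K]_(m, n) => y i j)) => //.
exact: coord_continuous.
Qed.

Lemma sum_continuous (T : topologicalType) (I : Type) (r : seq I) (P : pred I)
    (F : I -> T -> K) (x : T) :
  (forall i, P i -> {for x, continuous (F i)}) ->
  {for x, continuous (fun y => \sum_(i <- r | P i) F i y)}.
Proof. by move=> Fc; apply: cvg_big => //; exact: add_continuous. Qed.

Lemma prod_continuous (T : topologicalType) (I : Type) (r : seq I) (P : pred I)
    (F : I -> T -> K) (x : T) :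
  (forall i, P i -> {for x, continuous (F i)}) ->
  {for x, continuous (fun y => \prod_(i <- r | P i) F i y)}.
Proof. by move=> Fc; apply: cvg_big => //; exact: mul_continuous. Qed.

Lemma exprn_cvg (T : Type) (F : set_system T) (FF : Filter F) (f : T -> K) (y : K) m :
  f @ F --> y -> f t ^+ m @[t --> F] --> y ^+ m.
Proof.
move=> fy; elim: m => [|m IH]; first by rewrite expr0; apply: cvg_cst.
rewrite (_ : (fun t => _) = fun t => f t * f t ^+ m).
  by rewrite exprS; exact: cvgM.
by apply/funext => t; rewrite exprS.
Qed.

Lemma exprn_continuous_at (T : topologicalType) (f : T -> K) (x : T) m :
  {for x, continuous f} -> {for x, continuous (fun y => f y ^+ m)}.
Proof. exact: exprn_cvg. Qed.

Lemma mulmx_continuous (T : topologicalType) m n p (f : T -> 'M[K]_(m, n))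
    (g : T -> 'M[K]_(n, p)) (x : T) :
  {for x, continuous f} -> {for x, continuous g} ->
  {for x, continuous (fun y => f y *m g y)}.
Proof.
move=> fc gc; apply: mx_continuous => i j.
rewrite (_ : (fun y => _) = fun y => \sum_k f y i k * g y k j); last first.
  by apply/funext => y; rewrite mxE.
apply: sum_continuous => k _; apply: continuousM.
  exact: coord_continuous_comp.
exact: coord_continuous_comp.
Qed.

End MatrixContinuity.

Section WGrTopology.
Variables (R : realType) (n d : nat) (W : 'I_n -> nat) (a : nat).
Hypotheses (d0 : (0 < d)%N) (a0 : (0 < a)%N).
Let M := @full_rank_mx R n d.
Let r := @wsim R n d W a.
Implicit Types (A B : M) (f : {ffun 'I_d -> 'I_n}).

(** Plücker coordinates turn the pair [(t, T)] into the single scalar [t]. Conversely, once the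
    coordinates agree, [plucker_eq] supplies a change of basis of determinant 1. *)
Lemma wsimP A B : wsim W a A B <-> exists2 t : Cplx R, t != 0 &
  forall f, plucker (val B) f = t ^+ wdeg W a f * plucker (val A) f.
Proof.
split=> [[t [T [t0 Tu tT ->]]]|[t t0 AB]].
  exists t => // f; rewrite pluckerM plucker_diag -tT exprD.
  by rewrite mulrC mulrA.
pose j0 := Ordinal d0.
(* Scaling one column by [t ^+ a] realizes the required determinant without extracting a root. *)
pose T0 : 'M[Cplx R]_d := diag_mx (\row_j (if j == j0 then t ^+ a else 1)).
have dT0 : \det T0 = t ^+ a.
  rewrite det_diag (bigD1 j0) //= mxE eqxx big1 ?mulr1 // => j jj0.
  by rewrite mxE (negPf jj0).
have := plucker_neq0 (set_valP B : \rank (val B) = d) => -[g Bg].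
pose A' := diag_mx (\row_i t ^+ W i) *m val A *m T0.
have AB' f : plucker A' f = plucker (val B) f.
  by rewrite AB pluckerM plucker_diag dT0 exprD mulrC mulrA.
have [|T Tu [T1 BE]] := plucker_eq (f := g) _ AB'; first by rewrite AB'.
exists t, (T0 *m T); split.
- by [].
- by rewrite unitmx_mul Tu andbT unitmxE dT0 unitfE expf_neq0.
- by rewrite det_mulmx dT0 T1 mulr1.
- by rewrite BE /A' !mulmxA.
Qed.

Lemma wproj_eq A B : quotient_proj r A = quotient_proj r B <-> wsim W a A B.
Proof. exact/quotient_proj_eq_equiv/wsim_equiv. Qed.

Lemma plucker_continuous f : continuous (fun A : M => plucker (val A) f).
Proof.
move=> A; rewrite /plucker /determinant; apply: sum_continuous => s _.
apply: (@continuousM _ _ (fun=> _)); first by apply: cst_continuous.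
apply: prod_continuous => i _.
rewrite (_ : (fun y : M => _) = fun y : M => val y (f i) (s i)); last first.
  by apply/funext => y; rewrite mxE.
by apply: coord_continuous_comp; exact: set_val_continuous.
Qed.

(** The saturation of [U] is the union of its preimages under the continuous maps given by the pairs
    [(t, T)]. *)
Lemma wproj_open (U : set M) : open U -> open (quotient_proj r @` U).
Proof.
move=> oU; rewrite /open /= /quotient_open.
rewrite [X in open X](_ : _ = \bigcup_(p in [set p : Cplx R * 'M[Cplx R]_d |
    [/\ p.1 != 0, p.2 \in unitmx & p.1 ^+ a = \det p.2]])
  [set B : M | exists2 A, U A &
     val A = diag_mx (\row_i p.1 ^+ W i) *m val B *m p.2]); last first.
  apply/seteqP; split=> [B [A UA /esym/wproj_eq[t [T [t0 Tu tT AB]]]]|B].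
    by exists (t, T) => //=; exists A.
  move=> [[t T] /= [t0 Tu tT] [A UA AE]]; exists A => //.
  by apply/esym/wproj_eq; exists t, T.
apply: bigcup_open => -[t T] /= [t0 Tu tT].
have act_full (B : M) : diag_mx (\row_i t ^+ W i) *m val B *m T \in M.
  apply/mem_set; rewrite /M /full_rank_mx /=.
  have [f Bf] := plucker_neq0 (set_valP B : \rank (val B) = d).
  apply: (@plucker_rank _ _ _ _ f); rewrite pluckerM plucker_diag -tT.
  by rewrite !mulf_neq0 // expf_neq0.
pose act (B : M) : M := exist (fun x => x \in M) _ (act_full B).
have actC : continuous act.
  apply: set_type_continuous => B.
  apply: (@mulmx_continuous _ M _ _ _ (fun B => diag_mx (\row_i t ^+ W i) *m val B)
    (fun=> T)); last by apply: cst_continuous.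
  apply: (@mulmx_continuous _ M _ _ _ (fun=> diag_mx (\row_i t ^+ W i)) val).
    by apply: cst_continuous.
  exact: set_val_continuous.
rewrite (_ : mkset _ = act @^-1` U); first by move/continuousP: actC; apply.
apply/seteqP; split=> [B [A UA AE]|B UB]; last by exists (act B).
by rewrite /preimage /= (_ : act B = A) //; apply/val_inj; rewrite /= AE.
Qed.

End WGrTopology.

(** Openness of the inequality jointly in the scalar and the two points, as the covering form of
    compactness requires. *)
Lemma near_neq_scale (K : numFieldType) (S T : topologicalType) (u : S -> K)
    (v : T -> K) (t : K) (x : S) (y : T) m :
  {for x, continuous u} -> {for y, continuous v} -> v y != t ^+ m * u x ->
  \forall t' \near t & p \near (x, y), v p.2 != t' ^+ m * u p.1.
Proof.
move=> uc vc vu.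
pose F (q : K * (S * T)) := v q.2.2 - q.1 ^+ m * u q.2.1.
have F0 : 0 < `|F (t, (x, y))| by rewrite normr_gt0 /F subr_eq0.
have FC : F q @[q --> (t, (x, y))] --> F (t, (x, y)).
  have p2 : q.2 @[q --> (t, (x, y))] --> (x, y) by exact: cvg_snd.
  have u2 : u q.2.1 @[q --> (t, (x, y))] --> u x.
    apply: (cvg_comp (fun q : K * (S * T) => q.2.1) u _ uc).
    exact: (cvg_comp _ _ p2 cvg_fst).
  have v2 : v q.2.2 @[q --> (t, (x, y))] --> v y.
    apply: (cvg_comp (fun q : K * (S * T) => q.2.2) v _ vc).
    exact: (cvg_comp _ _ p2 cvg_snd).
  by apply: cvgB => //; apply: cvgM => //; apply: exprn_cvg; exact: cvg_fst.
have /cvgrPdist_lt/(_ _ F0) := FC; apply: filterS => -[t' [x' y']] /= Fq.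
rewrite -subr_eq0 -/(F (t', (x', y'))).
by apply: contraTneq Fq => ->; rewrite subr0 ltxx.
Qed.

(** * Separation of inequivalent points *)

Section WGrHausdorff.
Variables (R : realType) (n d : nat) (W : 'I_n -> nat) (a : nat).
Hypotheses (d0 : (0 < d)%N) (a0 : (0 < a)%N).
Let M := @full_rank_mx R n d.
Let r := @wsim R n d W a.
Implicit Types (A B : M) (f : {ffun 'I_d -> 'I_n}).

(** As the projection is open, it suffices that inequivalence is an open condition on pairs. Near
    [(A, B)] any scalar relating two matrices stays in a fixed compact set [K], and each scalar in
    [K] is excluded on a neighbourhood by some coordinate. *)
Lemma WGr_hausdorff : hausdorff_space (WGr R d W a).
Proof.
rewrite open_hausdorff => p q; have [A <-] := quotient_proj_surj p.
have [B <-] := quotient_proj_surj q => /eqP/wproj_eq AB.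
suff H : \forall s \near (A, B), ~ wsim W a s.1 s.2.
  case: H => -[U V] /= [nU nV] UV.
  exists (quotient_proj r @` U°, quotient_proj r @` V°) => /=.
    by rewrite !inE; split; [exists A|exists B] => //; exact: nbhs_singleton (nbhs_interior _).
  split; [by apply: wproj_open; exact: open_interior..|].
  apply/eqP/seteqP; split=> // _ [[A' UA' <-] [B' VB' /esym/wproj_eq A'B']].
  have /= := UV (A', B') (conj (interior_subset UA') (interior_subset VB')).
  exact.
have [g Ag] := plucker_neq0 (set_valP A : \rank (val A) = d).
have [h Bh] := plucker_neq0 (set_valP B : \rank (val B) = d).
have Apos : 0 < `|plucker (val A) g| / 2.
  by apply: divr_gt0; rewrite ?normr_gt0 ?ltr0n.
(* A scalar of modulus above [b] would enlarge a coordinate of size over half of that of [A] beyond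
   the bound valid near [B]; the exponents are at least 1, and [b >= 1]. *)
pose b : Cplx R := 1 + (`|plucker (val B) g| + 1) / (`|plucker (val A) g| / 2).
have b1 : 1 <= b by rewrite lerDl !divr_ge0 // addr_ge0.
have bE : RtoC (complex.Re b) = b.
  by rewrite /RtoC RRe_real // ger0_real // (le_trans ler01).
have [K cK KP] := closed_disc_compact (complex.Re b).
have pA f : plucker (val A') f @[A' --> A] --> plucker (val A) f.
  exact: plucker_continuous.
have pB f : plucker (val B') f @[B' --> B] --> plucker (val B) f.
  exact: plucker_continuous.
have Abig : \forall A' \near A, `|plucker (val A) g| / 2 < `|plucker (val A') g|.
  have /cvgrPdist_lt/(_ _ Apos) := pA g; apply: filterS => A'.
  move=> /(le_lt_trans (lerB_dist _ _)); rewrite ltrBlDr => H.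
  by rewrite -(ltrD2l (`|plucker (val A) g| / 2)) -splitr.
have Bsmall : \forall B' \near B, `|plucker (val B') g| < `|plucker (val B) g| + 1.
  have /cvgrPdist_lt/(_ _ ltr01) := pB g; apply: filterS => B'.
  rewrite distrC => /(le_lt_trans (lerB_dist _ _)).
  by rewrite ltrBlDr addrC.
have cover : \forall p \near (A, B), K `<=` (fun t => exists f,
    plucker (val p.2) f != t ^+ wdeg W a f * plucker (val p.1) f).
  apply: (iffLR (compact_near_coveringP K) cK (M * M)%type (nbhs (A, B))
    (fun p t => exists f, plucker (val p.2) f != t ^+ wdeg W a f * plucker (val p.1) f)).
  move=> t Kt.
  have [f ft] : exists f, plucker (val B) f != t ^+ wdeg W a f * plucker (val A) f.
    apply: contrapT => /forallNP H; apply: AB; apply/(wsimP W a d0).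
    have {}H f : plucker (val B) f = t ^+ wdeg W a f * plucker (val A) f.
      by apply/eqP/negP => /negP; exact: H.
    (* The compact set may contain 0, but [t = 0] would annihilate all coordinates of [B], the
       exponents being positive. *)
    exists t => //; apply: contraNneq Bh => t0.
    by rewrite H t0 expr0n addn_eq0 (gtn_eqF a0) mul0r.
  have ptC B' := @plucker_continuous R n d f B'.
  apply: filterS (near_neq_scale (ptC A) (ptC B) ft) => -[t' s] /= st.
  by exists f.
have both : \forall s \near (A, B), `|plucker (val A) g| / 2 < `|plucker (val s.1) g| /\
    `|plucker (val s.2) g| < `|plucker (val B) g| + 1.
  by exists ([set A' : M | `|plucker (val A) g| / 2 < `|plucker (val A') g|],
    [set B' : M | `|plucker (val B') g| < `|plucker (val B) g| + 1]).
apply: filterS2 cover both => -[A' B'] /= AB'0 [A'g B'g] /(wsimP W a d0)[t t0 AB'].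
have Kt : K t.
  apply: KP; rewrite bE.
  rewrite real_leNgt ?realE ?normr_ge0 ?(le_trans ler01 b1) //; apply/negP => bt.
  have t1 : 1 <= `|t| by rewrite (le_trans b1) // ltW.
  have : b * (`|plucker (val A) g| / 2) < `|plucker (val B') g|.
    rewrite AB' normrM normrX ltr_pM ?(le_trans ler01 b1) ?(ltW Apos) //.
    rewrite (lt_le_trans bt) // ler_eXnr // /wdeg addn_gt0 a0 //.
  rewrite /b mulrDl mul1r divfK ?gt_eqF // => /lt_trans/(_ B'g).
  by rewrite gtrDr (lt_gtF Apos).
have [f] := AB'0 t Kt; rewrite AB' eqxx //.
Qed.

End WGrHausdorff.

(** * Frames in a Schubert cell *)

Lemma prim_root_exists (C : numClosedFieldType) m : (0 < m)%N ->
  exists z : C, m.-primitive_root z.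
Proof.
move=> m0; pose p : {poly C} := 'X^m - 1.
have [r pr] := closed_field_poly_normal p.
rewrite (monicP _) ?monicXnsubC // scale1r in pr.
have ur : uniq r.
  by rewrite -separable_prod_XsubC -pr separable_Xn_sub_1 // pnatr_eq0 -lt0n.
have rr : all m.-unity_root r by apply/allP => z; rewrite -root_prod_XsubC -pr.
have sr : (m < (size r).+1)%N by rewrite -(size_prod_XsubC r id) -pr size_XnsubC.
by have /hasP[z _ zP] := has_prim_root m0 rr ur sr; exists z.
Qed.

Section CellFrames.
Variables (C : numClosedFieldType) (n d : nat) (i0 : 'I_n) (S : {set 'I_n}).
Variables (W : 'I_n -> nat) (a : nat).
Hypotheses (Sd : #|S| = d) (a0 : (0 < a)%N).
Let l := pivot i0 S.
Implicit Types (w : nat -> 'cV[C]_n) (A : 'M[C]_(n, d)) (f : {ffun 'I_d -> 'I_n}).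

Lemma pivot_lt i j : (i < j < d)%N -> (l i < l j)%N.
Proof. by rewrite -Sd; exact: pivot_mono. Qed.

Let wadm w := forall j, (j < d)%N -> admissible l w j.

Lemma frame_mx_echelon w : wadm w -> echelon i0 (frame_mx d l w) S.
Proof. by move=> wa i j ij; rewrite mxE (frame_high pivot_lt wa). Qed.

Lemma plucker_frame_mx w : wadm w ->
  plucker (frame_mx d l w) (pivots d i0 S) = \prod_(j < d) w j (l j) 0.
Proof.
move=> wa; rewrite /plucker -det_tr det_trig; last first.
  apply/is_trig_mxP => i j ij; rewrite !mxE ffunE.
  by rewrite (frame_high pivot_lt wa) // pivot_lt // ij /=.
by apply: eq_bigr => j _; rewrite !mxE ffunE (frame_coord pivot_lt wa).
Qed.

Lemma sum_plucker_frame_mx w : wadm w ->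
  \sum_f `|plucker (frame_mx d l w) f| ^+ 2 = d`!%:R.
Proof.
by move=> wa; apply: sum_plucker_orthonormal => i j; exact: (frame_mx_orthonormal pivot_lt wa).
Qed.

(** Inverting [t] reduces to the case of modulus at least 1, where no term of the sum decreases.
    Equal sums then force each term to stay the same, including a nonzero one. *)
Lemma scale_norm1 (t : C) (u v : {ffun 'I_d -> 'I_n} -> C) :
  t != 0 -> (forall f, v f = t ^+ wdeg W a f * u f) ->
  (exists f, u f != 0) ->
  \sum_f `|u f| ^+ 2 = \sum_f `|v f| ^+ 2 -> `|t| = 1.
Proof.
wlog t1 : t u v / 1 <= `|t|.
  move=> H t0 vu [f uf] uv.
  have [/H|] := real_leP (@real1 C) (normr_real t); first by apply; [|exact: vu|exists f|].
  move=> /ltW t1; have := H t^-1 v u; rewrite normfV => {}H.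
  apply/eqP; rewrite -invr_eq1; apply/eqP; apply: H => //.
  - by rewrite invf_ge1 // normr_gt0.
  - by rewrite invr_eq0.
  - by move=> g; rewrite vu exprVn mulKf // expf_neq0.
  - by exists f; rewrite vu mulf_neq0 // expf_neq0.
move=> t0 vu [f uf] uv.
have H : \sum_g (`|v g| ^+ 2 - `|u g| ^+ 2) = 0 by rewrite sumrB uv subrr.
have vE g : `|v g| ^+ 2 = `|t| ^+ (wdeg W a g * 2) * `|u g| ^+ 2.
  by rewrite vu normrM normrX exprMn exprM.
have le g : 0 <= `|v g| ^+ 2 - `|u g| ^+ 2.
  by rewrite subr_ge0 vE ler_peMl ?exprn_ge0 // exprn_ege1.
have /eqP := H; rewrite psumr_eq0 => [|g _]; last exact: le.
move=> /allP/(_ f (mem_index_enum _)) /=.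
rewrite vE subr_eq0 -subr_eq0 -{2}[_ ^+ 2]mul1r -mulrBl mulf_eq0.
rewrite orbC expf_eq0 normr_eq0 (negPf uf) andbF /= subr_eq0.
by rewrite pexpr_eq1 // ?muln_gt0 ?addn_gt0 ?a0 // => /eqP.
Qed.

Let c := wdeg W a (pivots d i0 S).

Lemma diag_frame_mx (z : 'I_n -> C) w w' : (forall i, `|z i| = 1) ->
  (forall j, (j < d)%N -> w' j = (z (l j))^* *: torus_act z (w j)) ->
  frame_mx d l w' = diag_mx (\row_i z i) *m frame_mx d l w *m
                    diag_mx (\row_(j < d) (z (l j))^*).
Proof.
move=> z1 w'E; apply/matrixP => i j.
rewrite mxE (frame_torus z1 w'E) // mul_mx_diag mul_diag_mx !mxE.
by rewrite mulrC.
Qed.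

(** Conjugation inverts [t], and [c] is [a] plus the sum of the weights of the pivot rows. The
    phases restoring real pivots thus have exactly the determinant demanded by [wsim]. *)
Lemma det_conj_pivots (t : C) : `|t| = 1 -> t ^+ c = 1 ->
  \det (diag_mx (\row_(j < d) (t ^+ W (l j))^*)) = t ^+ a.
Proof.
move=> t1 tc; rewrite det_diag.
have t0 : t != 0 by rewrite -normr_eq0 t1 oner_eq0.
have tJ : t^* = t^-1 by apply: (mulfI t0); rewrite divff // -normCK t1 expr1n.
have wE : (\sum_j W (pivots d i0 S j))%N = (\sum_(j < d) W (l j))%N.
  by apply: eq_bigr => j _; rewrite ffunE.
under eq_bigr do rewrite mxE rmorphXn /= tJ.
rewrite -expr_sum exprVn -[RHS](mulfK (expf_neq0 (\sum_(j < d) W (l j)) t0)).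
by rewrite -exprD -wE -/(wdeg W a _) -/c tc mul1r.
Qed.

(** Equal Plücker norms give modulus 1; the pivot coordinates are positive, so [t ^+ c] is positive
    and hence 1. The torus translate [w2] of [w] then has the same column span as [w'], and
    uniqueness of frames identifies the two. *)
Lemma generic_frame_rigid w w' (t : C) T : generic d l w -> generic d l w' ->
  t != 0 -> T \in unitmx -> t ^+ a = \det T ->
  frame_mx d l w' = diag_mx (\row_i t ^+ W i) *m frame_mx d l w *m T ->
  [/\ `|t| = 1, t ^+ c = 1 & forall j, (j < d)%N ->
      w' j = (t ^+ W (l j))^* *: torus_act (fun i => t ^+ W i) (w j)].
Proof.
move=> wg wg' t0 Tu tT wT.
have wa : wadm w by move=> j /wg[].
have wa' : wadm w' by move=> j /wg'[].
have pE f : plucker (frame_mx d l w') f = t ^+ wdeg W a f * plucker (frame_mx d l w) f.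
  by rewrite wT pluckerM plucker_diag -tT exprD mulrC mulrA.
have prod_gt0 (v : nat -> 'cV[C]_n) : generic d l v -> 0 < \prod_(j < d) v j (l j) 0.
  by move=> vg; apply: prodr_gt0 => j _; have [] := vg j (ltn_ord j).
have t1 : `|t| = 1.
  apply: (scale_norm1 t0 pE); last by rewrite !sum_plucker_frame_mx.
  by exists (pivots d i0 S); rewrite plucker_frame_mx // gt_eqF // prod_gt0.
have tc : t ^+ c = 1.
  have := pE (pivots d i0 S); rewrite !plucker_frame_mx // -/c => E.
  have : 0 < t ^+ c by rewrite -(pmulr_lgt0 _ (prod_gt0 w wg)) -E prod_gt0.
  by move=> /gtr0_norm <-; rewrite normrX t1 expr1n.
split=> //.
pose z i := t ^+ W i; have z1 i : `|z i| = 1 by rewrite normrX t1 expr1n.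
pose w2 j := (z (l j))^* *: torus_act z (w j).
have w2E := @diag_frame_mx z w w2 z1 (fun _ _ => erefl).
have zz i : (z i)^* * z i = 1 by rewrite mulrC -normCK z1 expr1n.
have w2g : generic d l w2.
  move=> j jd; have [[w1 w0 wh wl] wp] := wg j jd; split.
    split.
    - rewrite /w2 dotZr dotZl conjCK mulrA zz mul1r -w1.
      by apply: eq_bigr => i _; rewrite !mxE rmorphM mulrACA zz mul1r.
    - by rewrite !mxE mulrA zz mul1r.
    - by move=> i ji; rewrite !mxE wh // !mulr0.
    - by move=> k kj; rewrite !mxE wl // !mulr0.
  by rewrite !mxE mulrA zz mul1r.
pose L : 'M[C]_d := diag_mx (\row_(j < d) (z (l j))^*).
have Lu : L \in unitmx.
  by rewrite unitmxE /L /z det_conj_pivots // unitfE expf_neq0.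
move=> j jd; apply/esym.
apply: (generic_frame_unique pivot_lt (T := invmx L *m T) w2g wg') jd.
by rewrite mulmxA w2E mulmxK.
Qed.

(** The modulus [rho] fixes the Plücker norm and a phase [u] makes the pivot coordinate positive.
    Orthonormalization then changes the coordinates by one common factor [dl], which is positive and
    norm preserving, hence 1. *)
Lemma in_cell_frame A (rho : C) : in_cell i0 A S -> 0 < rho ->
  \sum_f `|plucker A f| ^+ 2 * rho ^+ (wdeg W a f * 2) = d`!%:R ->
  exists2 w, generic d l w & exists2 t : C, t != 0 &
    forall f, plucker (frame_mx d l w) f = t ^+ wdeg W a f * plucker A f.
Proof.
move=> AS rho0 rhoA; have [_ pS _] := AS.
have c0 : (0 < c)%N by rewrite addn_gt0 a0.
set p := plucker A (pivots d i0 S) in pS.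
have np : `|p| != 0 by rewrite normr_eq0.
(* The pivot coordinate scales by the [c]-th power, so a [c]-th root of its inverse phase is
   needed. *)
pose u := c.-root (p^* / `|p|).
have uc : u ^+ c = p^* / `|p| by rewrite rootCK.
have u1 : `|u| = 1.
  apply/eqP; rewrite -(pexpr_eq1 c0 (normr_ge0 u)) -normrX uc normf_div norm_conjC normr_id divff //.
pose t := rho * u.
have un0 : u != 0 by rewrite -normr_eq0 u1 oner_eq0.
have t0 : t != 0 by rewrite mulf_neq0 // gt_eqF.
have tn : `|t| = rho by rewrite normrM u1 mulr1 gtr0_norm.
have tcp : 0 < t ^+ c * p.
  rewrite exprMn uc -mulrA mulrAC [_^* * _]mulrC -normCK expr2 mulfK //.
  by rewrite mulr_gt0 ?exprn_gt0 // normr_gt0.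
pose B := diag_mx (\row_i t ^+ W i) *m A.
have Bf f : plucker B f = t ^+ (\sum_i W (f i)) * plucker A f.
  by rewrite plucker_diag.
have B0 f : (plucker B f != 0) = (plucker A f != 0).
  by rewrite Bf mulf_eq0 expf_eq0 (negPf t0) andbF.
have BS : in_cell i0 B S.
  by have [_ pA mA] := AS; split=> [||f]; rewrite ?B0 //; exact: mA.
have [T Tu [T1 TE]] := in_cell_echelon BS.
have [|j|w wg [T' wE]] := echelon_frame pivot_lt (B := B *m T); first exact: TE.
  have /matrixP/(_ j j) := T1; rewrite [LHS]mxE ffunE [RHS]mxE eqxx => ->.
  exact: oner_neq0.
exists w => //.
have wa : wadm w by move=> j /wg[].
pose dl := \det (T *m T') / t ^+ a.
have pE f : plucker (frame_mx d l w) f = dl * (t ^+ wdeg W a f * plucker A f).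
  rewrite wE -mulmxA pluckerM Bf /dl exprD; field.
  by rewrite expf_neq0.
clearbody dl.
have dl0 : 0 < dl.
  have := pE (pivots d i0 S); rewrite plucker_frame_mx // -/c -/p => E.
  rewrite -(pmulr_lgt0 _ tcp) -E; apply: prodr_gt0 => j _.
  by have [] := wg j (ltn_ord j).
have dl1 : dl = 1.
  have := sum_plucker_frame_mx wa.
  rewrite (eq_bigr (fun f => dl ^+ 2 * (`|plucker A f| ^+ 2 * rho ^+ (wdeg W a f * 2)))).
    rewrite -mulr_sumr rhoA => /eqP; rewrite -subr_eq0 -{2}[_%:R]mul1r -mulrBl.
    rewrite mulf_eq0 pnatr_eq0 -[(_ == 0)%N]negbK -lt0n fact_gt0 orbF.
    by rewrite subr_eq0 sqrp_eq1 ?ltW // => /eqP.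
  move=> f _; rewrite pE !normrM normrX tn (gtr0_norm dl0) !exprMn exprM.
  by rewrite [X in _ = _ * X]mulrC.
by exists t => // f; rewrite pE dl1 mul1r.
Qed.

End CellFrames.

(** * Coordinates on a closed cell *)

Section FrameContinuity.
Variables (C : numClosedFieldType) (T : topologicalType) (n d : nat) (l : nat -> 'I_n).
Variables (w : T -> nat -> 'cV[C]_n) (x : T).
Implicit Types (u v : T -> 'cV[C]_n).

Lemma conj_continuous : continuous (fun z : C => z^*).
Proof.
move=> z; apply: (iffRL (@cvgrPdist_lt _ _ _ _ (nbhs_filter z) _ _)) => e e0.
have zz : id z' @[z' --> z] --> z by exact: cvg_id.
have := iffLR (@cvgrPdist_lt _ _ _ _ (nbhs_filter z) _ _) zz _ e0.
by apply: filterS => z' /=; rewrite -rmorphB norm_conjC.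
Qed.

Lemma dot_continuous u v : {for x, continuous u} -> {for x, continuous v} ->
  {for x, continuous (fun y => dot (u y) (v y))}.
Proof.
move=> uc vc; apply: sum_continuous => i _; apply: continuousM.
  apply: (@continuous_comp _ _ _ (fun y => u y i 0) (fun z : C => z^*)).
    exact: coord_continuous_comp.
  exact: conj_continuous.
exact: coord_continuous_comp.
Qed.

Lemma refl_continuous u v k : {for x, continuous u} -> {for x, continuous v} ->
  1 + u x k 0 != 0 -> {for x, continuous (fun y => refl (u y) k (v y))}.
Proof.
move=> uc vc u0.
have ec : {for x, continuous (fun y => u y + delta_mx k 0)}.
  by apply: continuousD; [exact: uc|apply: cst_continuous].
apply: continuousB; first exact: vc.
apply: continuousZ; last exact: ec.
apply: continuousM; first exact: dot_continuous.
apply: continuousV; first exact: u0.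
apply: continuousD; first by apply: cst_continuous.
exact: coord_continuous_comp.
Qed.

Lemma frame_mx_continuous : (forall j, {for x, continuous (fun y => w y j)}) ->
  (forall j, (j < d)%N -> 1 + w x j (l j) 0 != 0) ->
  {for x, continuous (fun y => frame_mx d l (w y))}.
Proof.
move=> wc w0.
have RtoC j v : (j <= d)%N -> {for x, continuous v} ->
    {for x, continuous (fun y => rotate l (w y) j (v y))}.
  elim: j v => [|j IH] v jd vc /=; first exact: vc.
  apply: (IH (fun y => refl (w y j) (l j) (v y))); first exact: ltnW.
  by apply: refl_continuous; [exact: wc|exact: vc|exact: w0].
apply: mx_continuous => i j.
rewrite (_ : (fun y => _) = fun y => frame l (w y) j i 0); last first.
  by apply/funext => y; rewrite mxE.
by apply: coord_continuous_comp; apply: RtoC; [exact: ltnW|exact: wc].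
Qed.

End FrameContinuity.

(* The denominator [1 - enorm x + N x] vanishes nowhere on the closed ball, so the
   origin needs no separate treatment. *)
Section RadialMap.
Variables (R : realType) (k : nat) (N : 'rV[R]_k -> R).
Implicit Types x y : 'rV[R]_k.

Definition enorm x : R := Num.sqrt (\sum_j x 0 j ^+ 2).

Hypotheses (Nc : continuous N) (NZ : forall a x, 0 <= a -> N (a *: x) = a * N x).
Hypotheses (N_gt0 : forall x, x != 0 -> 0 < N x) (N_le : forall x, N x <= enorm x).

Definition squeeze x := (1 - enorm x + N x)^-1 *: x.
Definition spread x := (1 + enorm x - N x)^-1 *: x.

Lemma disk_enorm x : disk x <-> enorm x <= 1.
Proof.
rewrite /disk /enorm /=; have s0 : 0 <= \sum_j x 0 j ^+ 2.
  by apply: sumr_ge0 => j _; exact: sqr_ge0.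
by rewrite -[X in Num.sqrt _ <= X]sqrtr1 ler_sqrt.
Qed.

Lemma sphere_enorm x : sphere x <-> enorm x = 1.
Proof.
rewrite /sphere /enorm /=; have s0 : 0 <= \sum_j x 0 j ^+ 2.
  by apply: sumr_ge0 => j _; exact: sqr_ge0.
split=> [->|s1]; first by rewrite sqrtr1.
by rewrite -(sqr_sqrtr s0) s1 expr1n.
Qed.

Lemma enormZ a x : 0 <= a -> enorm (a *: x) = a * enorm x.
Proof.
move=> a0; rewrite /enorm (eq_bigr (fun j => a ^+ 2 * x 0 j ^+ 2)).
  by rewrite -mulr_sumr sqrtrM ?sqr_ge0 // sqrtr_sqr ger0_norm.
by move=> j _; rewrite mxE exprMn.
Qed.

Lemma enorm_ge0 x : 0 <= enorm x. Proof. exact: sqrtr_ge0. Qed.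

Lemma enorm0 : enorm 0 = 0.
Proof. by rewrite -(scale0r (0 : 'rV[R]_k)) enormZ // mul0r. Qed.

Lemma squeeze_denom x : enorm x <= 1 -> 0 < 1 - enorm x + N x.
Proof.
rewrite le_eqVlt => /predU1P[x1|x1].
  rewrite x1 subrr add0r N_gt0 //; apply/eqP => x0.
  by move: x1; rewrite x0 enorm0 => /eqP; rewrite eq_sym oner_eq0.
have [->|/N_gt0 Nx] := eqVneq x 0.
  by rewrite enorm0 subr0 -(scale0r (0 : 'rV[R]_k)) NZ // mul0r addr0.
by rewrite addr_gt0 // subr_gt0.
Qed.

Lemma N_squeeze x : enorm x <= 1 -> N (squeeze x) <= 1.
Proof.
move=> x1; have D0 := squeeze_denom x1.
by rewrite NZ ?invr_ge0 ?(ltW D0) // ler_pdivrMl // mulr1 lerDr subr_ge0.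
Qed.

(** By homogeneity the value is [N x / (1 - enorm x + N x)]; hence the round boundary goes to the
    boundary of the unit ball of [N]. *)
Lemma N_squeeze_lt1 x : enorm x <= 1 -> (N (squeeze x) < 1) = (enorm x < 1).
Proof.
move=> x1; have D0 := squeeze_denom x1.
by rewrite NZ ?invr_ge0 ?(ltW D0) // ltr_pdivrMl // mulr1 ltrDr subr_gt0.
Qed.

Lemma squeezeK x : enorm x <= 1 -> spread (squeeze x) = x.
Proof.
move=> x1; have D0 := squeeze_denom x1; rewrite /spread /squeeze.
set D := 1 - enorm x + N x in D0 *.
have Dn0 : D != 0 by rewrite gt_eqF.
rewrite enormZ ?NZ ?invr_ge0 ?(ltW D0) // scalerA.
rewrite [X in X *: _](_ : _ = 1) ?scale1r //.
(* The left side is [(D + enorm x - N x) / D], and the numerator is 1 by the choice of [D]. *)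
rewrite (_ : 1 + D^-1 * enorm x - D^-1 * N x = D^-1) ?invrK ?mulfV //.
by rewrite -addrA -mulrBr -[X in X + _](mulVf Dn0) -mulrDr /D -[RHS]mulr1; congr (_ * _); ring.
Qed.

Lemma spread_denom y : 0 < 1 + enorm y - N y.
Proof. by rewrite -addrA ltr_wpDr ?subr_ge0. Qed.

Lemma spreadK y : squeeze (spread y) = y.
Proof.
have D0 := spread_denom y; rewrite /spread /squeeze.
set D := 1 + enorm y - N y in D0 *.
have Dn0 : D != 0 by rewrite gt_eqF.
rewrite enormZ ?NZ ?invr_ge0 ?(ltW D0) // scalerA.
rewrite [X in X *: _](_ : _ = 1) ?scale1r //.
rewrite (_ : 1 - D^-1 * enorm y + D^-1 * N y = D^-1) ?invrK ?mulfV //.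
rewrite -addrA -mulrN -mulrDr -[X in X + _](mulVf Dn0) -mulrDr /D -[RHS]mulr1; congr (_ * _); ring.
Qed.

Lemma enorm_spread y : N y < 1 -> enorm (spread y) < 1.
Proof.
move=> y1; have D0 := spread_denom y.
rewrite enormZ ?invr_ge0 ?(ltW D0) // ltr_pdivrMl // mulr1.
by rewrite addrAC ltrDr subr_gt0.
Qed.

Lemma enorm_continuous : continuous enorm.
Proof.
move=> x; apply: (@continuous_comp _ _ _ (fun x : 'rV[R]_k => \sum_j x 0 j ^+ 2)).
  exact: continuous_sum_sqr.
exact: sqrt_continuous.
Qed.

Lemma squeeze_continuous x : enorm x <= 1 -> {for x, continuous squeeze}.
Proof.
move=> x1; apply: continuousZ; last exact: cvg_id.
apply: continuousV; first by rewrite gt_eqF // squeeze_denom.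
apply: continuousD; last exact: Nc.
by apply: continuousB; [apply: cst_continuous|exact: enorm_continuous].
Qed.

End RadialMap.

(** * Real coordinates of a cell and the polydisk norm *)

Section Coordinates.
Variables (R : realType) (n d : nat) (i0 : 'I_n) (S : {set 'I_n}).
(** Each free entry contributes a real part, tagged [false], and an imaginary part, tagged
    [true]. *)
Definition coord_index : finType :=
  ({p : 'I_d * 'I_n | p \in free_entries d i0 S} * bool)%type.
Local Notation free_index := {p : 'I_d * 'I_n | p \in free_entries d i0 S}.
Let k := #|coord_index|.
Implicit Types (x y : 'rV[R]_k) (p : free_index).

Definition coor x p (b : bool) : R := x 0 (enum_rank ((p, b) : coord_index)).

Definition of_coor (c : free_index -> bool -> R) : 'rV[R]_k :=
  \row_m c (enum_val m).1 (enum_val m).2.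

Lemma of_coorK c p b : coor (of_coor c) p b = c p b.
Proof. by rewrite /coor mxE enum_rankK. Qed.

Lemma coor_inj x y : (forall p b, coor x p b = coor y p b) -> x = y.
Proof.
move=> xy; apply/rowP => m; have := xy (enum_val m).1 (enum_val m).2.
by rewrite /coor -surjective_pairing enum_valK.
Qed.

Lemma coorZ a x p b : coor (a *: x) p b = a * coor x p b.
Proof. by rewrite /coor mxE. Qed.

Lemma coorD x y p b : coor (x + y) p b = coor x p b + coor y p b.
Proof. by rewrite /coor mxE. Qed.

Definition coor_sq x p : R := coor x p false ^+ 2 + coor x p true ^+ 2.

Lemma coor_sq_ge0 x p : 0 <= coor_sq x p.
Proof. by rewrite addr_ge0 // sqr_ge0. Qed.

Lemma sum_sqrE x : \sum_j x 0 j ^+ 2 = \sum_p coor_sq x p.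
Proof.
rewrite (reindex (@enum_rank coord_index)) /=; last exact/onW_bij/enum_rank_bij.
rewrite (eq_bigr (fun q : coord_index => coor x q.1 q.2 ^+ 2)); last first.
  by move=> q _; rewrite /coor -surjective_pairing.
rewrite -(pair_bigA _ (fun p b => coor x p b ^+ 2)) /=.
by apply: eq_bigr => p _; rewrite big_bool /= /coor_sq addrC.
Qed.

Definition block x (j : nat) : R :=
  \sum_(p : free_index | (val p).1 == j :> nat) coor_sq x p.

Lemma block_ge0 x j : 0 <= block x j.
Proof. by apply: sumr_ge0 => p _; exact: coor_sq_ge0. Qed.

Lemma sum_block x : \sum_j x 0 j ^+ 2 = \sum_(j < d) block x j.
Proof. by rewrite sum_sqrE (partition_big (fun p : free_index => (val p).1) xpredT). Qed.

Lemma blockZ a x j : block (a *: x) j = a ^+ 2 * block x j.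
Proof.
rewrite mulr_sumr; apply: eq_bigr => p _.
by rewrite /coor_sq !coorZ !exprMn mulrDr.
Qed.

(** Its closed unit ball is the product of the closed balls in which the columns [x_j] vary,
    [block x j] being the square of |x_j|. *)
Definition block_norm x : R := \big[Num.max/0]_(j < d) Num.sqrt (block x j).

Lemma block_normZ a x : 0 <= a -> block_norm (a *: x) = a * block_norm x.
Proof.
move=> a0; rewrite /block_norm.
rewrite (big_morph (fun z => a * z) (id1 := 0) (op1 := Num.max)) ?mulr0 //.
  by apply: eq_bigr => j _; rewrite blockZ sqrtrM ?sqr_ge0 // sqrtr_sqr ger0_norm.
by move=> u v; rewrite maxr_pMr.
Qed.

Lemma block_norm_ge x (j : 'I_d) : Num.sqrt (block x j) <= block_norm x.
Proof. exact: le_bigmax. Qed.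

Lemma block_norm_gt0 x : x != 0 -> 0 < block_norm x.
Proof.
apply: contraNT; rewrite -leNgt => N0; apply/eqP/coor_inj => p b.
have B0 : block x (val p).1 = 0.
  apply/eqP; rewrite eq_le block_ge0 andbT -sqrtr_eq0 eq_le sqrtr_ge0 andbT.
  exact: le_trans (block_norm_ge x (val p).1) N0.
have /eqP := B0; rewrite psumr_eq0 => [|q _]; last exact: coor_sq_ge0.
move=> /allP/(_ p (mem_index_enum _)); rewrite eqxx /= paddr_eq0 ?sqr_ge0 //.
rewrite !sqrf_eq0 => /andP[/eqP f0 /eqP t0].
by rewrite [RHS]mxE; case: b.
Qed.

Lemma block_norm_le x : block_norm x <= enorm x.
Proof.
apply/bigmax_leP; split=> [|j _]; first exact: enorm_ge0.
rewrite /enorm sum_block ler_sqrt; last by apply: sumr_ge0 => i _; exact: block_ge0.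
by rewrite (bigD1 j) //= lerDl; apply: sumr_ge0 => i _; exact: block_ge0.
Qed.

Lemma coor_continuous p b : continuous (fun x => coor x p b).
Proof. exact: coord_continuous. Qed.

Lemma coor_sq_continuous p : continuous (fun x => coor_sq x p).
Proof.
move=> x.
have H b : {for x, continuous (fun y => coor y p b ^+ 2)}.
  by apply: exprn_continuous_at; exact: coor_continuous.
exact: (continuousD (H false) (H true)).
Qed.

Lemma block_continuous j : continuous (fun x => block x j).
Proof. by move=> x; apply: sum_continuous => p _; exact: coor_sq_continuous. Qed.

Lemma block_norm_continuous : continuous block_norm.
Proof.
apply: continuous_big => [|j _].
  exact: max_continuous.
move=> x; apply: (@continuous_comp _ _ _ (fun x => block x j)).
  exact: block_continuous.
exact: sqrt_continuous.
Qed.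

Lemma block_norm_le1 x (j : 'I_d) : block_norm x <= 1 -> block x j <= 1.
Proof.
move=> /(le_trans (block_norm_ge x j)).
by rewrite -[X in _ <= X -> _]sqrtr1 ler_sqrt.
Qed.

Lemma block_norm_lt1 x : block_norm x < 1 <-> forall j : 'I_d, block x j < 1.
Proof.
have E j : (Num.sqrt (block x j) < 1) = (block x j < 1).
  by rewrite -[X in _ < X]sqrtr1 ltr_sqrt.
split=> [x1 j|H]; first by rewrite -E (le_lt_trans (block_norm_ge x j)).
by apply/bigmax_ltP; split=> // j _; rewrite E.
Qed.

End Coordinates.

Section ComplexCoordinates.
Variables (R : realType) (n d : nat) (i0 : 'I_n) (S : {set 'I_n}).
Hypothesis Sd : #|S| = d.
Local Notation C := (Cplx R).
Let l := pivot i0 S.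
Local Notation free_index := {p : 'I_d * 'I_n | p \in free_entries d i0 S}.
Let k := #|coord_index d i0 S|.
Implicit Types (x y : 'rV[R]_k) (p q : free_index).

Lemma free_indexP p : ((val p).2 < l (val p).1)%N /\ (val p).2 \notin S.
Proof. by have := valP p; rewrite inE => /andP. Qed.

Definition ccoor x p : C := (coor x p false +i* coor x p true)%C.

Lemma ccoor_norm x p : `|ccoor x p| ^+ 2 = RtoC (coor_sq x p).
Proof. exact: (esym (add_Re2_Im2 (ccoor x p))). Qed.

Lemma ccoor_inj x y : (forall p, ccoor x p = ccoor y p) -> x = y.
Proof. by move=> xy; apply: coor_inj => p b; case: (xy p) => xf xt; case: b. Qed.

Lemma ccoor_continuous p : continuous (fun x => ccoor x p).
Proof.
move=> x; rewrite (_ : (fun x => _) =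
    fun x => RtoC (coor x p false) + ('i%C : C) * RtoC (coor x p true)); last first.
  by apply/funext => y; rewrite [LHS]cplxE.
have H b : {for x, continuous (fun y => RtoC (coor y p b))}.
  apply: (@continuous_comp _ _ _ (fun y => coor y p b)).
    exact: coor_continuous.
  exact: RtoC_continuous.
have iC : {for x, continuous (fun=> 'i%C : C)} by apply: cst_continuous.
exact: (continuousD (H false) (continuousM iC (H true))).
Qed.

(* The sum has at most one term. *)
Definition entry x (j : nat) (i : 'I_n) : C :=
  \sum_(p : free_index | ((val p).1 == j :> nat) && ((val p).2 == i)) ccoor x p.

Lemma entry_pred1 p : (fun q => ((val q).1 == (val p).1 :> nat) && ((val q).2 == (val p).2))
  =1 pred1 p.
Proof.
move=> q; apply/andP/eqP => [[/eqP/val_inj e1 /eqP e2]|->]; last by rewrite !eqxx.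
by apply/val_inj; rewrite [val q]surjective_pairing e1 e2 -surjective_pairing.
Qed.

Lemma entryE x p : entry x (val p).1 (val p).2 = ccoor x p.
Proof. by apply: big_pred1 => q; exact: entry_pred1. Qed.

Lemma entry0 x j i :
  (forall p, ((val p).1 == j :> nat) && ((val p).2 == i) = false) -> entry x j i = 0.
Proof. exact: big_pred0. Qed.

Lemma entry_in0 x j i : i \in S -> entry x j i = 0.
Proof.
move=> iS; apply: entry0 => p; apply/negP => /andP[_ /eqP pi].
by have [_] := free_indexP p; rewrite pi iS.
Qed.

Lemma entry_high0 x j (i : 'I_n) : (l j <= i)%N -> entry x j i = 0.
Proof.
move=> ji; apply: entry0 => p; apply/negP => /andP[/eqP pj /eqP pi].
by have [] := free_indexP p; rewrite pj pi ltnNge ji.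
Qed.

Lemma entry_norm x j : \sum_i `|entry x j i| ^+ 2 = RtoC (block x j).
Proof.
rewrite /RtoC rmorph_sum (partition_big (fun p : free_index => (val p).2) xpredT) => [|p _].
  apply: eq_bigr => i _.
  have [p /andP[/eqP pj /eqP pi]|p0] := pickP (fun p : free_index =>
    ((val p).1 == j :> nat) && ((val p).2 == i)).
    rewrite -pj -pi entryE (eq_bigl _ _ (entry_pred1 p)) big_pred1_eq.
    exact: ccoor_norm.
  rewrite entry0 => [|p]; last exact: p0.
  by rewrite big_pred0 => [|p]; [rewrite normr0 expr0n|exact: p0].
by [].
Qed.

(** The square root is 0 on negative numbers, so the formula is continuous everywhere, though it
    gives unit vectors only for [block x j <= 1]. *)
Definition wvec x (j : nat) : 'cV[C]_n :=
  \col_i (if i == l j then RtoC (Num.sqrt (1 - block x j)) else entry x j i).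

Lemma wvec_pivot x j : wvec x j (l j) 0 = RtoC (Num.sqrt (1 - block x j)).
Proof. by rewrite mxE eqxx. Qed.

Lemma wvec_entry x j i : i != l j -> wvec x j i 0 = entry x j i.
Proof. by rewrite mxE => /negPf ->. Qed.

Lemma wvec_admissible x j : (j < d)%N -> block x j <= 1 -> admissible l (wvec x) j.
Proof.
move=> jd b1.
have jS : l j \in S by apply: pivot_in; rewrite Sd.
split.
- rewrite dotE (bigD1 (l j)) //= wvec_pivot.
  rewrite (eq_bigr (fun i => `|entry x j i| ^+ 2)); last first.
    by move=> i il; rewrite wvec_entry.
  have := entry_norm x j; rewrite (bigD1 (l j)) //= (entry_in0 _ _ jS) normr0 expr0n add0r => ->.
  rewrite /RtoC ger0_norm; last by rewrite ler0c sqrtr_ge0.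
  rewrite -rmorphXn sqr_sqrtr ?subr_ge0 // -rmorphD subrK.
  exact: rmorph1.
- by rewrite wvec_pivot /RtoC ler0c sqrtr_ge0.
- move=> i ji; rewrite wvec_entry; last by rewrite -val_eqE gtn_eqF.
  exact/entry_high0/ltnW.
- move=> m mj; have md := ltn_trans mj jd.
  rewrite wvec_entry; first by apply: entry_in0; apply: pivot_in; rewrite Sd.
  by apply/eqP => /pivot_inj; rewrite Sd => /(_ md jd) mE; rewrite mE ltnn in mj.
Qed.

Lemma wvec_generic x : (forall j, (j < d)%N -> block x j < 1) -> generic d l (wvec x).
Proof.
move=> b1 j jd; split; first by apply: wvec_admissible; last exact/ltW/b1.
by rewrite wvec_pivot /RtoC ltcR sqrtr_gt0 subr_gt0 b1.
Qed.

Lemma wvec_inj x y : (forall j, (j < d)%N -> wvec x j = wvec y j) -> x = y.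
Proof.
move=> xy; apply: ccoor_inj => p; rewrite -!entryE.
have pl : (val p).2 != l (val p).1.
  by have [H _] := free_indexP p; rewrite -val_eqE ltn_eqF.
by rewrite -!(wvec_entry _ pl) xy.
Qed.

(** The free entries are the coordinates; all other entries off the pivot vanish, and the positive
    pivot is determined by the unit length. *)
Lemma wvec_surj w : generic d l w ->
  exists2 x, (forall j, (j < d)%N -> block x j < 1) &
             forall j, (j < d)%N -> wvec x j = w j.
Proof.
move=> wg.
pose c p : C := w (val p).1 (val p).2 0.
pose x := of_coor (fun p b => if b then complex.Im (c p) else complex.Re (c p)).
have cE p : ccoor x p = c p by rewrite /ccoor !of_coorK; case: (c p).
have eE j (i : 'I_n) : (j < d)%N -> i != l j -> entry x j i = w j i 0.
  move=> jd il; have [[_ _ wh wl] _] := wg j jd.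
  have [iS|iS] := boolP (i \in S).
    rewrite entry_in0 //; have [m md mi] := pivotP i0 iS; rewrite Sd in md.
    have [mj|jm|mj] := ltngtP m j.
    - by rewrite -mi wl.
    - by rewrite wh // -mi pivot_mono // Sd jm md.
    - by rewrite -mi -mj eqxx in il.
  have [ij|ji|/val_inj ij] := ltngtP i (l j).
  - have pF : (Ordinal jd, i) \in free_entries d i0 S by rewrite inE /= ij iS.
    pose p : free_index := exist (fun ji : 'I_d * 'I_n => ji \in free_entries d i0 S) _ pF.
    by have := entryE x p; rewrite cE.
  - by rewrite (entry_high0 _ (ltnW ji)) wh.
  - by rewrite ij eqxx in il.
have bE j : (j < d)%N -> RtoC (1 - block x j) = w j (l j) 0 ^+ 2.
  move=> jd; have [[w1 w0 wh wl] wp] := wg j jd.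
  have jS : l j \in S by apply: pivot_in; rewrite Sd.
  have := entry_norm x j; rewrite (bigD1 (l j)) //= (entry_in0 _ _ jS) normr0 expr0n add0r.
  rewrite (eq_bigr (fun i => `|w j i 0| ^+ 2)) => [e1|i il]; last by rewrite eE.
  move: w1; rewrite dotE (bigD1 (l j)) //= e1 (ger0_norm w0) => e2.
  by rewrite -[RHS](addrK (RtoC (block x j))) e2 /RtoC rmorphB rmorph1.
have b1 j : (j < d)%N -> block x j < 1.
  move=> jd; have [_ wp] := wg j jd.
  have : 0 < RtoC (1 - block x j) by rewrite bE // exprn_gt0.
  by rewrite /RtoC ltcR subr_gt0.
exists x => // j jd; apply/colP => i.
have [->|il] := eqVneq i (l j); last by rewrite wvec_entry // eE.
have [[_ w0 _ _] _] := wg j jd.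
have s0 : 0 <= RtoC (Num.sqrt (1 - block x j)) by rewrite /RtoC ler0c sqrtr_ge0.
apply/eqP; rewrite wvec_pivot -(eqrXn2 (n := 2)) // -bE //.
by rewrite /RtoC -rmorphXn sqr_sqrtr // subr_ge0 ltW // b1.
Qed.

Lemma wvec_continuous j : continuous (fun x => wvec x j).
Proof.
move=> x; apply: mx_continuous => i m.
rewrite (_ : (fun y => _) = fun y =>
    if i == l j then RtoC (Num.sqrt (1 - block y j)) else entry y j i); last first.
  by apply/funext => y; rewrite mxE.
case: eqP => _; last by apply: sum_continuous => p _; exact: ccoor_continuous.
apply: (@continuous_comp _ _ _ (fun y => Num.sqrt (1 - block y j))).
  apply: (@continuous_comp _ _ _ (fun y => 1 - block y j)).
    have oneC : {for x, continuous (fun=> 1 : R)} by apply: cst_continuous.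
    exact: (continuousB oneC (@block_continuous _ _ _ _ _ _ x)).
  exact: sqrt_continuous.
exact: RtoC_continuous.
Qed.

Section TorusAction.
Variable z : 'I_n -> C.
Hypothesis z1 : forall i, `|z i| = 1.

(** The second factor is the phase that makes the pivot of the column real again. *)
Definition twist p : C := z (val p).2 * (z (l (val p).1))^*.

Definition rotate_coords x : 'rV[R]_k :=
  of_coor (fun p b => if b then complex.Im (twist p * ccoor x p)
                      else complex.Re (twist p * ccoor x p)).

Lemma ccoor_rotate x p : ccoor (rotate_coords x) p = twist p * ccoor x p.
Proof. by rewrite {1}/ccoor !of_coorK; case: (_ * _). Qed.

Lemma rotate_coords_linear a x y :
  rotate_coords (a *: x + y) = a *: rotate_coords x + rotate_coords y.
Proof.
apply: ccoor_inj => p.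
have cpL u v : ccoor (a *: u + v) p = RtoC a * ccoor u p + ccoor v p.
  by rewrite /ccoor !coorD !coorZ /RtoC; simpc.
by rewrite cpL !ccoor_rotate cpL mulrDr mulrCA.
Qed.

Lemma rotate_coordsZ a x : rotate_coords (a *: x) = a *: rotate_coords x.
Proof.
have r0 : rotate_coords 0 = 0.
  have := rotate_coords_linear 1 0 0; rewrite !scale1r addr0 => /eqP.
  by rewrite -subr_eq subrr => /eqP/esym.
by rewrite -[a *: x]addr0 rotate_coords_linear r0 addr0.
Qed.

Lemma block_rotate x j : block (rotate_coords x) j = block x j.
Proof.
apply: eq_bigr => p _; apply: complexI; rewrite -!/(RtoC _) -!ccoor_norm ccoor_rotate.
by rewrite normrM normrM norm_conjC !z1 !mul1r.
Qed.

Lemma wvec_rotate x j : (j < d)%N ->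
  wvec (rotate_coords x) j = (z (l j))^* *: torus_act z (wvec x j).
Proof.
move=> jd; apply/colP => i; rewrite [RHS]mxE [X in _ * X]mxE.
have zz : (z (l j))^* * z (l j) = 1 by rewrite mulrC -normCK z1 expr1n.
have [->|il] := eqVneq i (l j).
  by rewrite !wvec_pivot mulrA zz mul1r block_rotate.
rewrite !wvec_entry //.
rewrite mulrA mulr_sumr; apply: eq_bigr => p /andP[/eqP pj /eqP pi].
by rewrite ccoor_rotate /twist pj pi [z i * _]mulrC.
Qed.

End TorusAction.
End ComplexCoordinates.

(** * Characteristic maps and the filtration *)

Section CyclicAction.
Variables (R : realType) (n d : nat) (i0 : 'I_n) (S : {set 'I_n}).
Variables (W : 'I_n -> nat) (c : nat).
Hypothesis c0 : (0 < c)%N.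
Let k := #|coord_index d i0 S|.
Implicit Types (x y : 'rV[R]_k).

Lemma mul_matrix_delta (f : 'rV[R]_k -> 'rV[R]_k) :
  (forall a x y, f (a *: x + y) = a *: f x + f y) ->
  forall x, x *m (\matrix_m f (delta_mx 0 m)) = f x.
Proof.
move=> fL x.
have fD u v : f (u + v) = f u + f v by rewrite -[u]scale1r fL !scale1r.
have f0 : f 0 = 0.
  by apply: (@addrI _ (f 0)); rewrite -fD !addr0.
have fZ a u : f (a *: u) = a *: f u by rewrite -[a *: u]addr0 fL f0 addr0.
rewrite mulmx_sum_row [in RHS](row_sum_delta x) (big_morph f fD f0).
by apply: eq_bigr => m _; rewrite rowK fZ.
Qed.

Lemma cyclic_representation : exists (gT : finGroupType) (G : {group gT})
    (rG : mx_representation R G k),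
  (forall g, g \in G -> exists2 t : Cplx R, t ^+ c = 1 &
     forall x, x *m rG g = rotate_coords (fun i => t ^+ W i) x) /\
  (forall t : Cplx R, t ^+ c = 1 -> exists2 g, g \in G &
     forall x, x *m rG g = rotate_coords (fun i => t ^+ W i) x).
Proof.
have [zeta zP] := prim_root_exists (Cplx R) c0.
(* This is the additive group of integers modulo [c], with [g] standing for the root of unity
   [zeta ^+ g]. *)
pose gT : finGroupType := 'I_c.-1.+1.
have cE : c.-1.+1 = c by rewrite prednK.
have modE m : (m %% c.-1.+1 = m %% c)%N by rewrite cE.
pose tw (t : Cplx R) x := rotate_coords (fun i => t ^+ W i) x.
pose A (g : gT) : 'M[R]_k := \matrix_m tw (zeta ^+ val g) (delta_mx 0 m).
have AE g x : x *m A g = tw (zeta ^+ val g) x.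
  by apply: mul_matrix_delta => a u v; exact: rotate_coords_linear.
have twM s t x : tw (s * t) x = tw t (tw s x).
  apply: ccoor_inj => p; rewrite !ccoor_rotate mulrA; congr (_ * _).
  by rewrite /twist !exprMn rmorphM mulrACA [LHS]mulrC.
have tw1 x : tw 1 x = x.
  apply: ccoor_inj => p; rewrite ccoor_rotate /twist !expr1n rmorph1 !mul1r.
  by [].
have mxE' (U V : 'M[R]_k) : (forall x, x *m U = x *m V) -> U = V.
  by move=> UV; apply/row_matrixP => m; rewrite !rowE.
have A_repr : mx_repr [set: gT]%G A.
  split=> [|g h _ _]; apply: mxE' => x.
    by rewrite mulmx1 AE expr0 tw1.
  rewrite mulmxA !AE -twM; congr (tw _ x).
  rewrite -exprD -(expr_mod _ (prim_expr_order zP)) -[in RHS](expr_mod _ (prim_expr_order zP)).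
  by rewrite /= modE modn_mod.
exists gT, [set: gT]%G, (MxRepresentation A_repr); split=> [g _|t tc].
  exists (zeta ^+ val g); last exact: AE.
  by rewrite exprAC (prim_expr_order zP) expr1n.
have /(prim_rootP zP)[i ti] := tc.
have ic : (i < c.-1.+1)%N by rewrite cE.
exists (Ordinal ic : gT); first by rewrite inE.
by move=> x; rewrite [LHS]AE ti.
Qed.

End CyclicAction.

Section CharacteristicMap.
Variables (R : realType) (n d : nat) (W : 'I_n -> nat) (a : nat).
Variables (i0 : 'I_n) (S : {set 'I_n}).
Hypotheses (d0 : (0 < d)%N) (a0 : (0 < a)%N) (Sd : #|S| = d).
Let l := pivot i0 S.
Let k := #|coord_index d i0 S|.
Let M := @full_rank_mx R n d.
Let X := WGr R d W a.
Let N : 'rV[R]_k -> R := @block_norm R n d i0 S.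
Let c := wdeg W a (pivots d i0 S).
Implicit Types (x y : 'rV[R]_k).

Definition char_mx x : 'M[Cplx R]_(n, d) := frame_mx d l (wvec (squeeze N x)).

Let NZ : forall b x, 0 <= b -> N (b *: x) = b * N x := @block_normZ R n d i0 S.
Let N_gt0 : forall x, x != 0 -> 0 < N x := @block_norm_gt0 R n d i0 S.

Lemma char_admissible x : enorm x <= 1 ->
  forall j, (j < d)%N -> admissible l (wvec (squeeze N x)) j.
Proof.
move=> x1 j jd; apply: wvec_admissible => //.
exact: (block_norm_le1 (Ordinal jd) (N_squeeze NZ N_gt0 x1)).
Qed.

Lemma char_generic x : enorm x < 1 -> generic d l (wvec (squeeze N x)).
Proof.
move=> x1; apply: wvec_generic => // j jd.
have : N (squeeze N x) < 1 by rewrite N_squeeze_lt1 // ltW.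
by move=> /block_norm_lt1/(_ (Ordinal jd)).
Qed.

(** The pivot coordinate is the product of the pivots, whose squares are 1 - |x_j|^2 at the squeezed
    point; it is nonzero exactly in the open polydisk. *)
Lemma char_mx_in_cell x : enorm x <= 1 ->
  (plucker (char_mx x) (pivots d i0 S) != 0) = (enorm x < 1).
Proof.
move=> x1; rewrite plucker_frame_mx //; last exact: char_admissible.
apply/idP/idP => [/prodf_neq0 H|/char_generic wg]; last first.
  by apply/prodf_neq0 => j _; rewrite gt_eqF //; have [] := wg j (ltn_ord j).
rewrite -(N_squeeze_lt1 NZ N_gt0) //; apply/block_norm_lt1 => j.
have := H j isT; rewrite wvec_pivot; apply: contraNT; rewrite -leNgt => b1.
by rewrite ler0_sqrtr ?subr_le0 // /RtoC rmorph0.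
Qed.

(** The squared Plücker norm is [d!] even on the boundary, so some coordinate is nonzero there
    too. *)
Lemma char_mx_full x : enorm x <= 1 -> char_mx x \in M.
Proof.
move=> x1; apply/mem_set.
have := sum_plucker_frame_mx Sd (char_admissible x1).
have [[f fx]|nf] := pselect (exists f, plucker (char_mx x) f != 0).
  by move=> _; exact: plucker_rank fx.
rewrite big1 => [/esym/eqP|f _].
  by rewrite pnatr_eq0 -[(_ == 0)%N]negbK -lt0n fact_gt0.
have [->|fx] := eqVneq (plucker (char_mx x) f) 0; first by rewrite normr0 expr0n.
by case: nf; exists f.
Qed.

Lemma disk_le1 (x : @disk R k) : enorm (val x) <= 1.
Proof. exact/disk_enorm/set_valP. Qed.

Definition char_pt (x : @disk R k) : M :=
  exist (fun A => A \in M) (char_mx (val x)) (char_mx_full (disk_le1 x)).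

Definition char_map (x : @disk R k) : X := quotient_proj _ (char_pt x).

Lemma char_map_continuous : continuous char_map.
Proof.
move=> x.
suff pc : {for x, continuous char_pt}.
  exact: (continuous_comp pc (@quotient_proj_continuous _ _ _)).
move: x; apply: set_type_continuous => x.
have sc : {for x, continuous (fun y : @disk R k => squeeze N (val y))}.
  apply: (@continuous_comp _ _ _ (val : @disk R k -> _) (squeeze N)).
    exact: set_val_continuous.
  apply: squeeze_continuous => //; [exact: block_norm_continuous|exact: disk_le1].
apply: (@frame_mx_continuous _ _ _ _ l (fun y : @disk R k => wvec (squeeze N (val y)))).
  move=> j; apply: (@continuous_comp _ _ _ (fun y : @disk R k => squeeze N (val y))
    (fun y => wvec y j)) => //.
  exact: wvec_continuous.
move=> j jd; have [_ w0 _ _] := char_admissible (disk_le1 x) jd.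
by rewrite gt_eqF // ltr_wpDr.
Qed.

Lemma char_pt_in_cell (x : @disk R k) :
  ~ sphere (val x) -> in_cell i0 (val (char_pt x)) S.
Proof.
move=> xs; apply: echelon_in_cell => //.
  exact: (frame_mx_echelon Sd (char_admissible (disk_le1 x))).
rewrite char_mx_in_cell ?disk_le1 // lt_neqAle disk_le1 andbT.
by apply/eqP => /sphere_enorm.
Qed.

Lemma char_pt_lower (x : @disk R k) S' : sphere (val x) ->
  in_cell i0 (val (char_pt x)) S' ->
  (weight (pivots d i0 S') < weight (pivots d i0 S))%N.
Proof.
move=> /sphere_enorm x1; apply: echelon_lower => //.
  exact: (frame_mx_echelon Sd (char_admissible (disk_le1 x))).
apply/eqP; apply: contraFT (ltxx (1 : R)) => px.
by rewrite -{1}x1 -char_mx_in_cell ?disk_le1.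
Qed.

Lemma in_cell_wsim (A B : M) S' :
  wsim W a A B -> in_cell i0 (val A) S' -> in_cell i0 (val B) S'.
Proof.
move=> /(wsimP W a d0)[t t0 AB] [Sd' pA mA].
have AB0 f : (plucker (val B) f != 0) = (plucker (val A) f != 0).
  by rewrite AB mulf_eq0 expf_eq0 (negPf t0) andbF.
by split=> // [|f]; rewrite AB0 //; exact: mA.
Qed.

Lemma enorm_rotate (z : 'I_n -> Cplx R) x : (forall i, `|z i| = 1) ->
  enorm (rotate_coords z x) = enorm x.
Proof.
move=> z1; rewrite /enorm !sum_block; congr Num.sqrt.
by apply: eq_bigr => j _; exact: block_rotate.
Qed.

Lemma squeeze_rotate (z : 'I_n -> Cplx R) x : (forall i, `|z i| = 1) ->
  squeeze N (rotate_coords z x) = rotate_coords z (squeeze N x).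
Proof.
move=> z1.
have NE : N (rotate_coords z x) = N x.
  by apply: eq_bigr => j _; rewrite block_rotate.
by rewrite /squeeze NE enorm_rotate // rotate_coordsZ.
Qed.

Lemma torus_norm1 (t : Cplx R) : t ^+ c = 1 -> `|t| = 1.
Proof.
move=> tc; apply/eqP; rewrite -(@pexpr_eq1 _ _ c) ?normr_ge0 ?addn_gt0 ?a0 //.
by rewrite -normrX tc normr1.
Qed.

Lemma char_map_rotate (x y : @disk R k) (t : Cplx R) : t ^+ c = 1 ->
  val y = rotate_coords (fun i => t ^+ W i) (val x) -> char_map x = char_map y.
Proof.
move=> tc yx; apply/wproj_eq.
have t1 := torus_norm1 tc.
have z1 i : `|t ^+ W i| = 1 by rewrite normrX t1 expr1n.
have t0 : t != 0 by rewrite -normr_eq0 t1 oner_eq0.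
exists t, (diag_mx (\row_(j < d) (t ^+ W (l j))^*)).
have dE := det_conj_pivots t1 tc.
split; [exact: t0| |exact: esym dE|].
  by rewrite unitmxE dE unitfE expf_neq0.
rewrite /= /char_mx yx squeeze_rotate //.
apply: diag_frame_mx => // j jd.
by apply: wvec_rotate.
Qed.

(** Cells are invariant under [wsim], so [y] is interior along with [x], and rigidity of generic
    frames applies. *)
Lemma char_map_inj (x y : @disk R k) : ~ sphere (val x) -> char_map x = char_map y ->
  exists2 t : Cplx R, t ^+ c = 1 & val y = rotate_coords (fun i => t ^+ W i) (val x).
Proof.
move=> xs /wproj_eq xy.
have yC := in_cell_wsim xy (char_pt_in_cell xs).
have y1 : enorm (val y) < 1 by rewrite -char_mx_in_cell ?disk_le1 //; have [] := yC.
have x1 : enorm (val x) < 1.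
  rewrite -char_mx_in_cell ?disk_le1 //; by have [] := char_pt_in_cell xs.
have [t [T [t0 Tu tT yE]]] := xy.
have [t1 tc wE] := generic_frame_rigid Sd a0 (char_generic x1) (char_generic y1) t0 Tu tT yE.
exists t; first exact: tc.
have z1 i : `|t ^+ W i| = 1 by rewrite normrX t1 expr1n.
have sE : squeeze N (val y) = squeeze N (rotate_coords (fun i => t ^+ W i) (val x)).
  rewrite squeeze_rotate //; apply: wvec_inj => j jd.
  by rewrite wE // wvec_rotate.
rewrite -(squeezeK NZ N_gt0 (disk_le1 y)) sE squeezeK //.
by rewrite enorm_rotate // disk_le1.
Qed.

End CharacteristicMap.

(** Intermediate values of a polynomial; this provides the positive scalar bringing a point to
    prescribed Plücker norm. *)
Lemma power_sum_eq (R : rcfType) (I : finType) (u : I -> R) (m : I -> nat) (D : R) :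
  (forall i, 0 <= u i) -> (exists i, 0 < u i) -> (forall i, (0 < m i)%N) -> 0 < D ->
  exists2 rho, 0 < rho & \sum_i u i * rho ^+ m i = D.
Proof.
move=> u0 [i0 ui0] m0 D0.
pose P : {poly R} := \sum_i u i *: 'X^(m i) - D%:P.
have PE x : P.[x] = \sum_i u i * x ^+ m i - D.
  by rewrite !hornerE horner_sum; congr (_ - _); apply: eq_bigr => i _; rewrite !hornerE.
have P0 : P.[0] < 0.
  rewrite PE big1 => [|i _]; first by rewrite sub0r oppr_lt0.
  by rewrite expr0n gtn_eqF // mulr0.
(* As [b >= 1], the term of [i0] alone is at least [u i0 * b = u i0 + D]. *)
pose b := 1 + D / u i0.
have b1 : 1 <= b by rewrite lerDl divr_ge0 // ltW.
have Pb : 0 <= P.[b].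
  rewrite PE subr_ge0 (bigD1 i0) //= ler_wpDr //.
    by apply: sumr_ge0 => i _; rewrite mulr_ge0 // exprn_ge0 // (le_trans ler01).
  rewrite (@le_trans _ _ (u i0 * b)) //.
    by rewrite /b mulrDr mulr1 mulrCA divff ?gt_eqF // mulr1 lerDr ltW.
  by rewrite ler_pM2l // ler_eXnr.
have [|rho /andP[rho0 _] /eqP rhoP] := @poly_ivt R P 0 b (le_trans ler01 b1).
  by rewrite (ltW P0) Pb.
exists rho; last by apply/eqP; rewrite -subr_eq0 -PE rhoP.
rewrite lt_neqAle rho0 andbT; apply: contraTneq P0 => r0.
by rewrite -r0 in rhoP; rewrite rhoP ltxx.
Qed.

(** * The Schubert filtration *)

Section Cells.
Variables (R : realType) (n d : nat) (W : 'I_n -> nat) (a : nat).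
Variables (i0 : 'I_n).
Hypotheses (d0 : (0 < d)%N) (a0 : (0 < a)%N).
Let M := @full_rank_mx R n d.
Let X := WGr R d W a.
Let proj (A : M) : X := quotient_proj _ A.
Implicit Types (S : {set 'I_n}).

(** A positive scalar normalizes the Plücker norm of [A] to that of a frame, [in_cell_frame] then
    gives a generic frame, and [spread] moves its coordinates into the open round ball. *)
Lemma char_map_surj S (Sd : #|S| = d) (A : M) : in_cell i0 (val A) S ->
  exists2 x, ~ sphere (val x) & char_map W a (i0 := i0) Sd x = proj A.
Proof.
move=> AS; pose u f : R :=
  complex.Re (plucker (val A) f) ^+ 2 + complex.Im (plucker (val A) f) ^+ 2.
have uE f : `|plucker (val A) f| ^+ 2 = RtoC (u f) by exact: esym (add_Re2_Im2 _).
have [||||rho rho0 rhoE] := @power_sum_eq R _ u (fun f => (wdeg W a f * 2)%N) d`!%:R.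
- by move=> f; rewrite addr_ge0 // sqr_ge0.
- exists (pivots d i0 S); have [_ pA _] := AS.
  have : 0 < RtoC (u (pivots d i0 S)) by rewrite -uE exprn_gt0 // normr_gt0.
  by rewrite /RtoC ltcR.
- by move=> f; rewrite muln_gt0 addn_gt0 a0.
- by rewrite ltr0n fact_gt0.
have rc0 : 0 < RtoC rho by rewrite /RtoC ltcR.
have rhoA : \sum_f `|plucker (val A) f| ^+ 2 * RtoC rho ^+ (wdeg W a f * 2) = d`!%:R.
  transitivity (RtoC (\sum_f u f * rho ^+ (wdeg W a f * 2))); last first.
    by rewrite rhoE /RtoC rmorph_nat.
  rewrite /RtoC rmorph_sum; apply: eq_bigr => f _.
  by rewrite uE /RtoC rmorphM rmorphXn.
have [w wg [t t0 tE]] := in_cell_frame Sd a0 AS rc0 rhoA.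
have [y y1 yw] := wvec_surj Sd wg.
have Ny : block_norm y < 1 by apply/block_norm_lt1 => j; exact: y1.
pose x := spread (@block_norm R n d i0 S) y.
have x1 : enorm x < 1 by apply: enorm_spread => //; exact: block_norm_le.
have xD : x \in @disk R #|coord_index d i0 S| by apply/mem_set/disk_enorm/ltW.
exists (exist (fun x => x \in @disk R _) x xD).
  by move=> /sphere_enorm /= xs; rewrite xs ltxx in x1.
apply/esym/wproj_eq/(wsimP W a d0); exists t => // f.
rewrite /= /char_mx spreadK; [|exact: block_normZ|exact: block_norm_le].
rewrite -tE; congr plucker; apply/matrixP => i j; rewrite !mxE.
by congr ((_ : 'cV__) i 0); apply: eq_frame => m mj; rewrite yw // (leq_ltn_trans mj).
Qed.

Definition pivot_order : rel {set 'I_n} :=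
  fun S S' => (weight (pivots d i0 S) <= weight (pivots d i0 S'))%N.

(** Sets of equal weight may come in any order, since boundaries reach only strictly smaller
    weights. *)
Definition pivot_sets : seq {set 'I_n} :=
  sort pivot_order (enum [pred S : {set 'I_n} | #|S| == d]).

Lemma mem_pivot_sets S : (S \in pivot_sets) = (#|S| == d).
Proof. by rewrite mem_sort mem_enum inE. Qed.

Lemma pivot_sets_uniq : uniq pivot_sets.
Proof. by rewrite sort_uniq enum_uniq. Qed.

Lemma pivot_sets_le i j : (i <= j < size pivot_sets)%N ->
  pivot_order (nth finset.set0 pivot_sets i) (nth finset.set0 pivot_sets j).
Proof.
move=> /andP[ij js].
have tr : transitive pivot_order by move=> ? ? ?; exact: leq_trans.
have rf : reflexive pivot_order by move=> ?; exact: leqnn.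
have tot : total pivot_order by move=> ? ?; exact: leq_total.
have iL : i \in [pred m | (m < size pivot_sets)%N] by exact: leq_ltn_trans js.
exact: (sorted_leq_nth tr rf finset.set0 (sort_sorted tot _) _ _ iL js ij).
Qed.

(** The first [m + 1] cells are taken, so stage 0 is already the zero-dimensional cell. *)
Definition stage (m : nat) : set X :=
  [set q | exists A S,
     [/\ q = proj A, in_cell i0 (val A) S & S \in take m.+1 pivot_sets]].

Lemma stage_in_cell m (A : M) S : in_cell i0 (val A) S ->
  stage m (proj A) -> S \in take m.+1 pivot_sets.
Proof.
move=> AS [B [S' [/wproj_eq AB BS' S'm]]].
by have /in_cell_unique/(_ BS') -> := in_cell_wsim d0 AB AS.
Qed.

Lemma stage_last : stage (size pivot_sets).-1 = setT.
Proof.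
apply/seteqP; split=> // q _; have [A <-] := quotient_proj_surj q.
have [S AS] := in_cell_exists i0 (set_valP A : \rank (val A) = d).
exists A, S; split=> //; have SL : S \in pivot_sets.
  by rewrite mem_pivot_sets; have [-> _ _] := AS.
by rewrite prednK ?take_size //; case: (pivot_sets) SL.
Qed.

Let piv m := nth finset.set0 pivot_sets m.

Lemma piv_card m : (m < size pivot_sets)%N -> #|piv m| = d.
Proof. by move=> ms; apply/eqP; rewrite -mem_pivot_sets mem_nth. Qed.

Lemma piv0_free : (0 < size pivot_sets)%N -> free_entries d i0 (piv 0) = finset.set0.
Proof.
move=> s0; apply: weight_min_free0; first exact: piv_card.
move=> S Sd; have SL : S \in pivot_sets by rewrite mem_pivot_sets Sd.
by rewrite -(nth_index finset.set0 SL); apply: pivot_sets_le; rewrite /= index_mem.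
Qed.

Lemma card_coord_index S : #|coord_index d i0 S| = (#|free_entries d i0 S| * 2)%N.
Proof. by rewrite card_prod card_bool card_sig; congr (_ * _)%N; apply: eq_card. Qed.

(** The first pivot set has least weight, hence no free entries, so its characteristic map starts
    from a space of row vectors of length 0. *)
Lemma stage0_unique (p q : X) : stage 0 p -> stage 0 q -> p = q.
Proof.
have [s0|s0] := ltnP 0 (size pivot_sets); last first.
  move=> [A [S [_ _]]]; rewrite take_oversize ?(leq_trans s0) //.
  by rewrite -has_pred1 has_count (leq_gtF (leq_trans (count_size _ _) s0)).
have tE : take 1 pivot_sets = [:: piv 0].
  by rewrite /piv; case: (pivot_sets) s0 => //= S s; rewrite take0.
have F0 := piv0_free s0; have Sd := piv_card s0.
have k0 : #|coord_index d i0 (piv 0)| = 0%N.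
  by rewrite card_coord_index F0 cards0.
suff H r : stage 0 r -> exists x, r = char_map W a (i0 := i0) Sd x.
  move=> /H[x ->] /H[y ->]; congr char_map; apply/val_inj/rowP => -[m mk].
  by exfalso; rewrite k0 in mk.
move=> [A [S [-> AS]]]; rewrite tE inE => /eqP SE; rewrite SE in AS.
by have [x _ <-] := char_map_surj Sd AS; exists x.
Qed.

Lemma stage_sub m : stage m `<=` stage m.+1.
Proof.
move=> q [A [S [-> AS Sm]]]; exists A, S; split=> //.
have [ms|ms] := ltnP m.+1 (size pivot_sets); last by move: Sm; rewrite !take_oversize // ltnW.
by rewrite (take_nth finset.set0) // mem_rcons inE Sm orbT.
Qed.

(** Interior points lie in cell [m.+1], which is not among the earlier ones. A boundary point lies
    in a cell of strictly smaller weight, which the sorting places earlier. *)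
Lemma char_map_stage m (ms : (m.+1 < size pivot_sets)%N) x :
  stage m (char_map W a (i0 := i0) (piv_card ms) x) <-> sphere (val x).
Proof.
have SL : piv m.+1 \in pivot_sets by rewrite mem_nth.
split=> [xm|xs].
  apply: contrapT => /(char_pt_in_cell (piv_card ms)) xS.
  have := stage_in_cell xS xm; rewrite in_take // index_uniq ?pivot_sets_uniq //.
  by rewrite ltnn.
have [S xS] := in_cell_exists i0 (set_valP (char_pt (i0 := i0) (piv_card ms) x) : \rank _ = d).
exists (char_pt (i0 := i0) (piv_card ms) x), S; split=> //.
have Sd : #|S| = d by have [] := xS.
have SL' : S \in pivot_sets by rewrite mem_pivot_sets Sd.
rewrite in_take // ltnNge; apply/negP => mS.
have := char_pt_lower xs xS; rewrite ltnNge => /negP; apply.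
rewrite -(nth_index finset.set0 SL'); apply: pivot_sets_le.
by rewrite mS index_mem.
Qed.

Lemma stageS m (ms : (m.+1 < size pivot_sets)%N) :
  stage m.+1 = stage m `|` range (char_map W a (i0 := i0) (piv_card ms)).
Proof.
apply/seteqP; split=> q; last first.
  case=> [|[x _ <-]]; first exact: stage_sub.
  have [xs|xs] := pselect (sphere (val x)).
    exact/stage_sub/char_map_stage.
  exists (char_pt (i0 := i0) (piv_card ms) x), (piv m.+1); split=> //.
    exact: char_pt_in_cell.
  by rewrite (take_nth finset.set0) // mem_rcons inE eqxx.
case=> A [S [-> AS]]; rewrite (take_nth finset.set0) // mem_rcons inE.
move=> /predU1P[SE|Sm]; last by left; exists A, S.
right; rewrite SE in AS; have [x _ <-] := char_map_surj (piv_card ms) AS.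
by exists x.
Qed.

(** The first pivot set is the only one without free entries, and the list has no repetitions. *)
Lemma coord_index_gt0 m (ms : (m.+1 < size pivot_sets)%N) :
  (0 < #|coord_index d i0 (piv m.+1)|)%N.
Proof.
rewrite card_coord_index muln_gt0 andbT card_gt0; apply/eqP => mF.
have s0 : (0 < size pivot_sets)%N by apply: leq_trans ms.
have := free0_unique (piv_card s0) (piv_card ms) (piv0_free s0) mF.
by move=> /eqP; rewrite nth_uniq // pivot_sets_uniq.
Qed.

Lemma stage_compact m : (m < size pivot_sets)%N -> compact (stage m).
Proof.
elim: m => [|m IH] ms.
  have [[q q0]|nq] := pselect (exists q, stage 0 q).
    rewrite (_ : stage 0 = [set q]); first exact: compact_set1.
    by apply/seteqP; split=> [r r0|r ->] //; exact: stage0_unique.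
  rewrite (_ : stage 0 = set0); first exact: compact0.
  by apply/seteqP; split=> // r r0; case: nq; exists r.
rewrite (stageS ms); apply: compact_setU_charmap; first exact/IH/ltnW.
exact: char_map_continuous.
Qed.

Lemma stage_attaches m (ms : (m.+1 < size pivot_sets)%N) :
  attaches_q_cell R (stage m) (stage m.+1).
Proof.
pose Sd := piv_card ms.
have c0 : (0 < wdeg W a (pivots d i0 (piv m.+1)))%N by rewrite addn_gt0 a0.
have [gT [G [rG [GT TG]]]] := cyclic_representation R d i0 (piv m.+1) W c0.
apply: (attaches_q_cell_charmap (rG := rG) (chi := char_map W a (i0 := i0) Sd)).
- exact: WGr_hausdorff.
- exact/stage_compact/ltnW.
- exact: coord_index_gt0.
- move=> g x /GT[t tc ->] /disk_enorm xD; apply/disk_enorm.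
  by rewrite enorm_rotate // => i; rewrite normrX (torus_norm1 a0 tc) expr1n.
- exact: char_map_continuous.
- move=> x y [g /GT[t tc tE] yx]; apply: (char_map_rotate a0 Sd tc).
  by rewrite yx tE.
- move=> x; exact: char_map_stage.
- move=> x y xm xy; have xs : ~ sphere (val x) by move=> /(char_map_stage ms)/xm.
  have [t tc yx] := char_map_inj d0 a0 xs xy.
  by have [g Gg gE] := TG t tc; exists g; [exact: Gg|rewrite gE; exact: yx].
- exact: stageS.
Qed.

End Cells.

Local Open Scope nat_scope.

Theorem proposition2p6 (R : realType) (n d : nat) (W : 'I_n -> nat) (a : nat)
  (hd : 0 < d) (hdn : d < n) (ha : 0 < a) :
  has_q_cell_structure R (WGr R d W a).
Proof.
pose i0 : 'I_n := Ordinal (ltn_trans hd hdn).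
(* One cell is used up by the initial stage, so the number of attachments is one less than the
   number of cells. *)
exists (size (pivot_sets d i0)).-1, (@stage R n d W a i0); split.
- move=> U; have [[u Uu]|nU] := pselect (exists u, U u).
    rewrite (_ : U = setT); first exact: openT.
    apply/seteqP; split=> // v _; rewrite (_ : v = u) //; apply/val_inj.
    by apply: (stage0_unique hd ha); exact: set_valP.
  rewrite (_ : U = set0); first exact: open0.
  by apply/seteqP; split=> // v Uv; case: nU; exists v.
- move=> m ms; split; first exact: stage_sub.
  by apply: stage_attaches => //; rewrite -ltn_predRL.
- exact: stage_last.
Qed.
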